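(* Let $\Lambda$ be a Noetherian semiperfect ring. Then $$\operatorname{depth}\Lambda \leq \operatorname{findim}\Lambda^{op} \leq \operatorname{dell}\Lambda.$$ If $\Lambda$ is Artinian, then $$\operatorname{depth}\Lambda \leq \operatorname{findim}\Lambda^{op} \leq \operatorname{Findim}\Lambda^{op} \leq \operatorname{dell}\Lambda.$$
   Context: Noetherian and Artinian mean two-sided. $\mathsf{Mod}\, \Lambda$ is the category of right $\Lambda$-modules, $\mathsf{mod}\, \Lambda$ the full subcategory of finitely presented ones; left modules are identified with modules over $\Lambda^{op}$. For $M \in \mathsf{mod}\,\Lambda$, $\operatorname{grade} M := \inf\{ i \geq 0 \mid \mathrm{Ext}^i_\Lambda(M,\Lambda) \neq 0\}$ ($\infty$ if there is none). $\operatorname{depth} \Lambda := \sup_S \operatorname{grade} S$, over simple $S \in \mathsf{mod}\,\Lambda$. $\operatorname{findim} \Gamma$ (resp. $\operatorname{Findim} \Gamma$) is the supremum of $\operatorname{projdim} M$ over all $M \in \mathsf{mod}\,\Gamma$ (resp. $M \in \mathsf{Mod}\,\Gamma$) of finite projective dimension. The stable category $\underline{\mathsf{mod}}\, \Lambda$ has the objects of $\mathsf{mod}\,\Lambda$, with morphisms taken modulo those factoring through projective objects; a stable retract is a retract in $\underline{\mathsf{mod}}\,\Lambda$. The syzygy functor $\Omega$ on $\underline{\mathsf{mod}}\,\Lambda$ is $\Omega M = \ker(P \twoheadrightarrow M)$ for any epimorphism from a projective $P$ in $\mathsf{mod}\,\Lambda$. For $M \in \mathsf{mod}\,\Lambda$,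 $\operatorname{dell} M := \inf\{ n \geq 0 \mid \Omega^n M \text{ is a stable retract of } \Omega^{n+1} N \text{ for some } N \in \underline{\mathsf{mod}}\, \Lambda\}$ ($\infty$ if no such $n$), and $\operatorname{dell} \Lambda := \sup_S \operatorname{dell} S$ over simple $S \in \mathsf{mod}\,\Lambda$. *)

(* Defs.v *)
From HB Require Import structures.
From mathcomp Require Import all_boot all_algebra.
From mathcomp Require Import boolp.

Set Implicit Arguments.
Unset Strict Implicit.
Unset Printing Implicit Defensive.

Import GRing.Theory.
Local Open Scope ring_scope.

(* The extended naturals, None being the value oo.                            *)
Definition enat := option nat.

Definition enat_le (x y : enat) : Prop :=
  match x, y with
  | _, None => True
  | None, Some _ => False
  | Some m, Some n => (m <= n)%N
  end.

Notation "x <=oo y" := (enat_le x y) (at level 70, no associativity).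

Definition enat_inf (P : nat -> Prop) : enat :=
  match pselect (exists n, `[< P n >]) with
  | left exP => Some (ex_minn exP)
  | right _ => None
  end.

(* The least upper bound; in particular the supremum of the empty set is 0.   *)
Definition enat_sup (X : enat -> Prop) : enat :=
  enat_inf (fun n => forall x, X x -> x <=oo Some n).

(* Everything below concerns LEFT modules over A, i.e. lmodType A; the        *)
(* corresponding notions for right modules over a ring L are obtained with    *)
(* A := L^c, the converse ring. Submodules are boolean predicates, which by   *)
(* the classical axioms are the same as arbitrary subsets.                    *)

Section Modules.
Variable A : pzRingType.
Implicit Types (M N P S X Y K : lmodType A).

Definition surjective M N (f : {linear M -> N}) : Prop :=
  forall y, exists x, f x = y.

Definition exact_at M N P (f : {linear M -> N}) (g : {linear N -> P}) : Prop :=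
  forall y, g y = 0 <-> exists x, f x = y.

Definition finitely_generated M : Prop :=
  exists n (f : {linear 'rV[A]_n -> M}), surjective f.

Definition finitely_presented M : Prop :=
  exists m n (g : {linear 'rV[A]_m -> 'rV[A]_n}) (f : {linear 'rV[A]_n -> M}),
    surjective f /\ exact_at g f.

Definition simple_module M : Prop :=
  (exists x : M, x != 0) /\
  forall U : {pred M}, submod_closed U ->
    (forall x, x \in U -> x = 0) \/ (forall x, x \in U).

Definition projective P : Prop :=
  forall M N (f : {linear M -> N}) (g : {linear P -> N}), surjective f ->
    exists h : {linear P -> M}, forall x, f (h x) = g x.

Definition superfluous M (V : M -> Prop) : Prop :=
  forall U : {pred M}, submod_closed U ->
    (forall x, exists u v, [/\ u \in U, V v & x = u + v]) ->
    forall x, x \in U.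

Definition has_projective_cover M : Prop :=
  exists P (f : {linear P -> M}),
    [/\ projective P, surjective f & superfluous (fun x => f x = 0)].

Record resolution M := Resolution {
  res_obj : nat -> lmodType A;
  res_diff : forall i, {linear res_obj i.+1 -> res_obj i};
  res_aug : {linear res_obj 0%N -> M};
  res_projective : forall i, projective (res_obj i);
  res_aug_surj : surjective res_aug;
  res_exact0 : exact_at (res_diff 0%N) res_aug;
  res_exactS : forall i, exact_at (res_diff i.+1) (res_diff i)
}.

Definition cocycle M N (F : resolution M) i
    (phi : {linear res_obj F i -> N}) : Prop :=
  forall x, phi (res_diff F i x) = 0.

Definition coboundary M N (F : resolution M) i :
    {linear res_obj F i -> N} -> Prop :=
  match i with
  | 0%N => fun phi => forall x, phi x = 0
  | j.+1 => fun phi => exists psi : {linear res_obj F j -> N},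
      forall x, phi x = psi (res_diff F j x)
  end.

(* Ext^i_A(M, N) <> 0, Ext^i being the i-th cohomology group of Hom(F, N).    *)
Definition Ext_neq0 i M N : Prop :=
  exists (F : resolution M) (phi : {linear res_obj F i -> N}),
    cocycle phi /\ ~ coboundary phi.

Definition grade M : enat := enat_inf (fun i => Ext_neq0 i M A^o).

Definition projdim M : enat :=
  enat_inf (fun n => exists F : resolution M,
    forall i, (n < i)%N -> forall x : res_obj F i, x = 0).

(* 0 -> K -> P -> M -> 0 with P a projective object of mod A, i.e. K is       *)
(* (a representative of) Omega M.                                             *)
Definition is_syzygy M K : Prop :=
  exists P (i : {linear K -> P}) (p : {linear P -> M}),
    [/\ finitely_presented P, projective P, injective i, surjective p
      & exact_at i p].

Fixpoint is_nth_syzygy n M X : Prop :=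
  match n with
  | 0%N => X = M
  | k.+1 => exists Y, is_nth_syzygy k M Y /\ is_syzygy Y X
  end.

(* f - g factors through a projective object of mod A.                        *)
Definition stably_equal M N (f g : M -> N) : Prop :=
  exists P (a : {linear M -> P}) (b : {linear P -> N}),
    [/\ finitely_presented P, projective P
      & forall x, f x - g x = b (a x)].

Definition stable_retract X Y : Prop :=
  exists (s : {linear X -> Y}) (r : {linear Y -> X}), stably_equal (r \o s) id.

Definition dell_module M : enat :=
  enat_inf (fun n => exists N X Y,
    [/\ finitely_presented N, is_nth_syzygy n M X, is_nth_syzygy n.+1 N Y
      & stable_retract X Y]).

End Modules.

Definition left_noetherian (A : pzRingType) : Prop :=
  forall I : nat -> {pred A^o},
    (forall n, submod_closed (I n)) ->
    (forall n, {subset I n <= I n.+1}) ->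
    exists n, forall m, (n <= m)%N -> I m =i I n.

Definition left_artinian (A : pzRingType) : Prop :=
  forall I : nat -> {pred A^o},
    (forall n, submod_closed (I n)) ->
    (forall n, {subset I n.+1 <= I n}) ->
    exists n, forall m, (n <= m)%N -> I m =i I n.

Definition noetherian (L : pzRingType) : Prop :=
  left_noetherian L /\ left_noetherian L^c.

Definition artinian (L : pzRingType) : Prop :=
  left_artinian L /\ left_artinian L^c.

(* Bass's definition, for right modules (it is left-right symmetric).          *)
Definition semiperfect (L : pzRingType) : Prop :=
  forall M : lmodType L^c, finitely_generated M -> has_projective_cover M.

(* depth L and dell L are computed with right L-modules.                      *)
Definition depth (L : pzRingType) : enat :=
  enat_sup (fun x => exists S : lmodType L^c,
    [/\ finitely_presented S, simple_module S & x = grade S]).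

Definition dell (L : pzRingType) : enat :=
  enat_sup (fun x => exists S : lmodType L^c,
    [/\ finitely_presented S, simple_module S & x = dell_module S]).

(* findim L^op and Findim L^op: right modules over L^op are left L-modules.   *)
Definition findim_op (L : pzRingType) : enat :=
  enat_sup (fun x => exists M : lmodType L,
    [/\ finitely_presented M, projdim M <> None & x = projdim M]).

Definition Findim_op (L : pzRingType) : enat :=
  enat_sup (fun x => exists M : lmodType L,
    projdim M <> None /\ x = projdim M).

(* Main.v *)
From HB Require Import structures.
From mathcomp Require Import all_boot all_algebra.
From mathcomp Require Import boolp classical_sets functions.
Require Import Defs.

(* If a simple right module S has grade at least n, dualizing a free          *)
(* resolution of S gives an exact complex of length n whose last cokernel C   *)
(* is finitely presented of projective dimension at most n; it is not smaller *)
(* since otherwise the dual of P_1 -> P_0 would be a split monomorphism,      *)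
(* P_1 -> P_0 would be onto and S would vanish.                               *)
(*                                                                            *)
(* Let M be a left module of projective dimension e + 1 > dell L, with        *)
(* syzygies M_j. If Omega^m S is a stable retract of Y = Omega^(m+1) N with   *)
(* m <= e, then Tor_1(Y, M_(e-m)) = Tor_1(N, M_(e+1)) = 0 because M_(e+1) is  *)
(* projective, so Tor_1(S, M_e) = Tor_1(Omega^m S, M_(e-m)) = 0. Hence it     *)
(* suffices that a sequence 0 -> P -> Q -> M_e -> 0 with P, Q projective      *)
(* splits when S (x) P -> S (x) Q is injective for every simple S. If P is    *)
(* finitely generated, the cokernel of Q^* -> P^* is a finitely generated     *)
(* right module without simple quotients, hence zero. If L is Artinian with   *)
(* radical J, the hypothesis says that P meets J Q in J P, so that P / J P is *)
(* a direct summand of Q / J Q, and a retraction lifts because J is nilpotent.*)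

(** The lower bound rests on [dual_cokernel_pd]: as long as the groups Ext(S, L) vanish, the dual of
    a free resolution of S stays exact, and each of its cokernels has projective dimension exactly
    one more than the previous one.

    The upper bound rests on trading syzygies of right modules for syzygies of left modules:
    Tor_1(Omega^k X, M) and Tor_1(X, Omega^k M) vanish together ([tor1_zero_nth_shift]). A delooping
    of Omega^m S supplies one extra syzygy, which pushes the left module into a projective term
    ([dell_tor1_zero]). Vanishing of Tor_1 against simple modules then has to force projectivity:
    [simple_tor1_fg_projective] does this for a finitely generated syzygy,
    [simple_tor1_artinian_projective] for any syzygy over an Artinian ring. [projdim_le_dell] is the
    argument common to both cases.

    No tensor product is formed: a map of free right modules acts as a matrix on powers of a left
    module ([act]), and Tor_1 is the failure of exactness there. *)

Set Implicit Arguments.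
Unset Strict Implicit.
Unset Printing Implicit Defensive.

Import GRing.Theory.
Local Open Scope ring_scope.

(** * Submodules and quotients *)

Section Submodules.
Variable A : pzRingType.
Implicit Types (C K M N P Q X Y : lmodType A).

Definition submodule M (U : M -> Prop) : Prop :=
  U 0 /\ forall a u v, U u -> U v -> U (a *: u + v).

Definition submodule_pred M (U : M -> Prop) : {pred M} := fun x => `[< U x >].

Lemma submodule_predE M (U : M -> Prop) x : (x \in submodule_pred U) <-> U x.
Proof. by split=> [/asboolP|?]; last apply/asboolP. Qed.

Lemma submodule_closed M (U : M -> Prop) :
  submodule U -> submod_closed (submodule_pred U).
Proof.
move=> [U0 UL]; split=> [|a u v]; first by apply/asboolP.
by move=> /asboolP Uu /asboolP Uv; apply/asboolP/UL.
Qed.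

Lemma submoduleD M (U : M -> Prop) x y :
  submodule U -> U x -> U y -> U (x + y).
Proof. by move=> [_ UL] Ux Uy; rewrite -[x]scale1r; apply: UL. Qed.

Lemma submoduleZ M (U : M -> Prop) a x : submodule U -> U x -> U (a *: x).
Proof. by move=> [U0 UL] Ux; rewrite -[_ *: _]addr0; apply: UL. Qed.

Lemma submoduleB M (U : M -> Prop) x y :
  submodule U -> U x -> U y -> U (x - y).
Proof.
by move=> sU Ux Uy; rewrite -scaleN1r; apply: submoduleD => //; apply: submoduleZ.
Qed.

Lemma submodule_sum M (U : M -> Prop) (I : Type) (r : seq I) (F : I -> M) :
  submodule U -> (forall i, U (F i)) -> U (\sum_(i <- r) F i).
Proof.
move=> sU UF; elim/big_ind: _ => //; first by case: sU.
by move=> *; apply: submoduleD.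
Qed.

Definition mklinear M N (f : M -> N) (fL : linear f) : {linear M -> N} :=
  HB.pack f (GRing.isLinear.Build A M N _ f fL).

Section SubmoduleType.
Variables (M : lmodType A) (U : M -> Prop) (sU : submodule U).

(** The closure proof is an argument of the key, so that the submodule structure can be inferred
    from the predicate alone. *)
Definition submodule_key of submodule U : {pred M} := submodule_pred U.
HB.instance Definition _ := GRing.isSubmodClosed.Build A M (submodule_key sU)
  (submodule_closed sU).

Definition submodule_type := {x : M | x \in submodule_key sU}.
HB.instance Definition _ := SubChoice.on submodule_type.
HB.instance Definition _ := [SubChoice_isSubLmodule of submodule_type by <:].

Lemma submodule_val_linear : linear (val : submodule_type -> M).
Proof. by move=> a u v; rewrite linearP. Qed.

End SubmoduleType.

Lemma submodule_exists M (U : M -> Prop) : submodule U ->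
  exists K (i : {linear K -> M}),
    injective i /\ forall y, U y <-> exists x, i x = y.
Proof.
move=> sU; exists (submodule_type sU), (mklinear (@submodule_val_linear _ _ sU)).
split=> [|y]; first exact: val_inj.
split=> [Uy|[x <-]]; last by move: (valP x) => /asboolP.
have Uy' : y \in submodule_key sU by apply/asboolP.
by exists (Sub y Uy').
Qed.

Section QuotientType.
Variables (M : lmodType A) (U : M -> Prop) (sU : submodule U).

Local Notation V := (submodule_key sU).
Definition quotient_type := Quotient.quot V.
HB.instance Definition _ := Choice.on quotient_type.
HB.instance Definition _ := GRing.Zmodule.on quotient_type.

Local Open Scope quotient_scope.

Definition quotient_pi (x : M) : quotient_type := \pi_(Quotient.quot V) x.
Definition quotient_repr (x : quotient_type) : M := repr (x : Quotient.quot V).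

Lemma quotient_reprK x : quotient_pi (quotient_repr x) = x.
Proof. exact: reprK. Qed.

Lemma quotient_piP x y : quotient_pi x = quotient_pi y <-> U (x - y).
Proof.
split=> [/eqP|Uxy].
  rewrite /quotient_pi -Quotient.idealrBE => /asboolP; exact.
by apply/eqP; rewrite -Quotient.idealrBE; apply/asboolP.
Qed.

Lemma quotient_piD x y : quotient_pi (x + y) = quotient_pi x + quotient_pi y.
Proof. exact: raddfD. Qed.

(** The additive group is that of [Quotient.quot]; scalars act through representatives, which is
    well defined by [quotient_piZ]. *)
Definition quotient_scale (a : A) (x : quotient_type) : quotient_type :=
  quotient_pi (a *: quotient_repr x).

Lemma quotient_piZ a x : quotient_pi (a *: x) = quotient_scale a (quotient_pi x).
Proof.
apply/quotient_piP; rewrite -scalerBr; apply: submoduleZ => //.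
by apply/quotient_piP; rewrite quotient_reprK.
Qed.

Fact quotient_scaleA a b v :
  quotient_scale a (quotient_scale b v) = quotient_scale (a * b) v.
Proof. by rewrite -[v]quotient_reprK -!quotient_piZ scalerA. Qed.
Fact quotient_scale1 : left_id 1 quotient_scale.
Proof. by move=> v; rewrite -[v]quotient_reprK -!quotient_piZ scale1r. Qed.
Fact quotient_scaleDr : right_distributive quotient_scale +%R.
Proof.
move=> a u v; rewrite -[u]quotient_reprK -[v]quotient_reprK.
by rewrite -quotient_piD -!quotient_piZ -quotient_piD scalerDr.
Qed.
Fact quotient_scaleDl v : {morph quotient_scale^~ v : a b / a + b}.
Proof.
move=> a b; rewrite -[v]quotient_reprK -!quotient_piZ.
by rewrite -quotient_piD scalerDl.
Qed.

HB.instance Definition _ := GRing.Zmodule_isLmodule.Build A quotient_type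
  quotient_scaleA quotient_scale1 quotient_scaleDr quotient_scaleDl.

Lemma quotient_pi_linear : linear quotient_pi.
Proof. by move=> a u v; rewrite quotient_piD quotient_piZ. Qed.

End QuotientType.

Lemma quotient_exists M (U : M -> Prop) : submodule U ->
  exists C (p : {linear M -> C}), surjective p /\ forall x, p x = 0 <-> U x.
Proof.
move=> sU; exists (quotient_type sU), (mklinear (@quotient_pi_linear _ _ sU)).
split=> [y|x]; first by exists (quotient_repr y); exact: quotient_reprK.
have <- : mklinear (@quotient_pi_linear _ _ sU) 0 = 0 by rewrite linear0.
by rewrite [X in X <-> _]quotient_piP subr0.
Qed.

Lemma factor_surjective P M N (p : {linear P -> M}) (h : {linear P -> N}) :
  surjective p -> (forall x, p x = 0 -> h x = 0) ->
  exists g : {linear M -> N}, forall x, g (p x) = h x.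
Proof.
move=> ps ph; have [s ps'] := choice ps.
have hE x y : p x = p y -> h x = h y.
  by move=> /eqP; rewrite -subr_eq0 -linearB => /eqP/ph/eqP;
    rewrite linearB subr_eq0 => /eqP.
have gL : linear (fun y => h (s y)).
  by move=> a u v; rewrite -linearP; apply: hE; rewrite linearP !ps'.
by exists (mklinear gL) => x; apply: hE; rewrite ps'.
Qed.

Lemma factor_injective K P X (i : {linear K -> P}) (f : {linear X -> P}) :
  injective i -> (forall x, exists k, i k = f x) ->
  exists g : {linear X -> K}, forall x, i (g x) = f x.
Proof.
move=> ii /choice[g ig]; have gL : linear g.
  by move=> a u v; apply: ii; rewrite linearP !ig linearP.
by exists (mklinear gL).
Qed.

Definition ses K P M (i : {linear K -> P}) (p : {linear P -> M}) : Prop :=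
  [/\ injective i, surjective p & exact_at i p].

Lemma exact_comp0 M N P (f : {linear M -> N}) (g : {linear N -> P}) x :
  exact_at f g -> g (f x) = 0.
Proof. by move=> fg; apply/fg; exists x. Qed.

Lemma kernel_submodule M N (f : {linear M -> N}) : submodule (fun x => f x = 0).
Proof.
split=> [|a u v u0 v0]; first exact: linear0.
by rewrite linearP u0 v0 scaler0 addr0.
Qed.

Lemma image_submodule M N (f : {linear M -> N}) :
  submodule (fun y => exists x, f x = y).
Proof.
split=> [|a _ _ [u <-] [v <-]]; first by exists 0; rewrite linear0.
by exists (a *: u + v); rewrite linearP.
Qed.

Lemma kernel_ses P M (p : {linear P -> M}) : surjective p ->
  exists K (i : {linear K -> P}), ses i p.
Proof.
have [K [i [ii iP]]] := submodule_exists (kernel_submodule p).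
by move=> ps; exists K, i; split.
Qed.

Lemma cokernel_exists M N (f : {linear M -> N}) :
  exists C (p : {linear N -> C}), surjective p /\ exact_at f p.
Proof. exact: quotient_exists (image_submodule f). Qed.

Lemma projective_retract P Q (s : {linear P -> Q}) (r : {linear Q -> P}) :
  cancel s r -> projective Q -> projective P.
Proof.
move=> sr Qp M N f g fs; have [h fh] := Qp M N f (g \o r) fs.
by exists (h \o s) => x /=; rewrite fh /= sr.
Qed.

End Submodules.

(** * Free modules and dual bases *)

Section FreeModules.
Variable A : pzRingType.
Implicit Types (C K M N P Q X Y : lmodType A).

Lemma row_comb_linear X n (y : 'I_n -> X) :
  linear (fun c : 'rV[A]_n => \sum_i c 0 i *: y i).
Proof.
move=> a u v; rewrite scaler_sumr -big_split; apply: eq_bigr => i _.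
by rewrite !mxE scalerDl scalerA.
Qed.

Definition row_comb X n (y : 'I_n -> X) : {linear 'rV[A]_n -> X} :=
  mklinear (row_comb_linear y).

Lemma row_combE X n (y : 'I_n -> X) c : row_comb y c = \sum_i c 0 i *: y i.
Proof. by []. Qed.

Lemma row_comb_delta X n (y : 'I_n -> X) i : row_comb y (delta_mx 0 i) = y i.
Proof.
rewrite row_combE (bigD1 i) //= mxE !eqxx scale1r big1 ?addr0 // => j ji.
by rewrite mxE (negPf ji) andbF scale0r.
Qed.

Lemma linear_rowE X n (f : {linear 'rV[A]_n -> X}) x :
  f x = \sum_i x 0 i *: f (delta_mx 0 i).
Proof.
by rewrite [x in LHS]row_sum_delta linear_sum; apply: eq_bigr => i _;
  rewrite linearZ.
Qed.

Lemma eq_linear_row X n (f g : {linear 'rV[A]_n -> X}) :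
  (forall i, f (delta_mx 0 i) = g (delta_mx 0 i)) -> forall x, f x = g x.
Proof.
by move=> fg x; rewrite !(linear_rowE _ x); apply: eq_bigr => i _; rewrite fg.
Qed.

Lemma row_projective n : projective 'rV[A]_n.
Proof.
move=> M N f g fs.
have /choice[m fm] i := fs (g (delta_mx 0 i)).
exists (row_comb m) => x.
apply: (@eq_linear_row _ _ (f \o row_comb m) g) => i.
by rewrite -fm -[in RHS](row_comb_delta m).
Qed.

(** * Free modules on an arbitrary set of generators *)

Section FinitelySupported.
Variable T : choiceType.

Definition supported_in (f : T -> A^o) (s : seq T) : Prop :=
  forall x, x \notin s -> f x = 0.

Lemma finsupp_submodule : submodule (fun f : T -> A^o => exists s, supported_in f s).
Proof.
split=> [|a f g [s fs] [t gt]]; first by exists [::].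
exists (s ++ t) => x; rewrite mem_cat negb_or => /andP[xs xt].
by rewrite !fctE fs // gt // scaler0 addr0.
Qed.

(** Lists stand for finite sets, so a sum over a support must not depend on the list chosen: both
    sides reduce to the sum over the points where f is nonzero. *)
Lemma supported_sum M (m : T -> M) f s t :
  supported_in f s -> supported_in f t ->
  \sum_(y <- undup s) (f y : A) *: m y = \sum_(y <- undup t) (f y : A) *: m y.
Proof.
have red r : supported_in f r -> \sum_(y <- undup r) (f y : A) *: m y =
    \sum_(y <- [seq y <- undup r | f y != 0]) (f y : A) *: m y.
  move=> _; rewrite big_filter [LHS](bigID (fun y => f y != 0)) /=.
  rewrite [X in _ + X]big1 ?addr0 // => y /negbNE/eqP ->.
  by rewrite scale0r.
move=> fs ft; rewrite red // (red t) //; apply: perm_big.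
apply: uniq_perm; rewrite ?filter_uniq ?undup_uniq // => y.
rewrite !mem_filter !mem_undup; case: eqP => //= /eqP fy.
have supp r : supported_in f r -> y \in r.
  by move=> fr; apply: contraNT fy => /fr ->.
by rewrite !supp.
Qed.

(** The basis vectors [d y] are the indicator functions. The lemmas below use only the three
    properties listed here. *)
Lemma free_exists : exists K (i : {linear K -> (T -> A^o)}) (d : T -> K),
  [/\ injective i, (forall x, exists s, supported_in (i x) s)
    & forall y, i (d y) = (fun z => (z == y)%:R)].
Proof.
have [K [i [ii iP]]] := submodule_exists finsupp_submodule.
have /choice[d dP] : forall y : T, exists x, i x = (fun z => (z == y)%:R).
  move=> y; apply/iP; exists [:: y] => z; rewrite inE => /negPf -> //.
by exists K, i, d; split=> // x; apply/iP; exists x.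
Qed.

Variables (K : lmodType A) (i : {linear K -> (T -> A^o)}) (d : T -> K).
Hypotheses (ii : injective i) (iP : forall x, exists s, supported_in (i x) s).
Hypothesis dP : forall y, i (d y) = (fun z => (z == y)%:R).

Lemma free_lift M (m : T -> M) : exists h : {linear K -> M},
  forall x s, supported_in (i x) s -> h x = \sum_(y <- undup s) (i x y : A) *: m y.
Proof.
have /choice[s sP] := iP.
pose h x := \sum_(y <- undup (s x)) (i x y : A) *: m y.
have hE x t : supported_in (i x) t -> h x = \sum_(y <- undup t) (i x y : A) *: m y.
  by move=> it; apply: supported_sum.
have hL : linear h.
  move=> a u v; pose t := s (a *: u + v) ++ s u ++ s v.
  have hEt w : {subset s w <= t} -> h w = \sum_(y <- undup t) (i w y : A) *: m y.
    by move=> wt; apply: hE => x xt; apply: sP; apply: contra xt => /wt.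
  rewrite !hEt => [|x|x|x]; try by rewrite !mem_cat => ->; rewrite ?orbT.
  rewrite scaler_sumr -big_split; apply: eq_bigr => y _.
  by rewrite linearP !fctE scalerDl scalerA.
by exists (mklinear hL).
Qed.

Lemma free_sum x s : supported_in (i x) s ->
  \sum_(y <- undup s) (i x y : A) *: d y = x.
Proof.
move=> xs; apply: ii; rewrite linear_sum fct_sumE; apply: funext => z.
have iZ a v : i (a *: v) z = a * i v z by rewrite linearZ.
have [zs|zs] := boolP (z \in s); last first.
  rewrite xs // big1_seq // => y /andP[_]; rewrite mem_undup => ys.
  rewrite iZ dP; case: eqP => [zy|_]; last by rewrite mulr0.
  by rewrite zy ys in zs.
rewrite (bigD1_seq z) ?mem_undup ?undup_uniq //= big1 ?addr0 => [|y yz].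
  by rewrite iZ dP eqxx mulr1.
by rewrite iZ dP eq_sym (negPf yz) mulr0.
Qed.

Lemma free_projective : projective K.
Proof.
move=> M N f g fs.
have /choice[m fm] y := fs (g (d y)).
have [h hP] := free_lift m; exists h => x.
have [s sP] := iP x; rewrite (hP x s) // -[in RHS](free_sum sP) !linear_sum.
by apply: eq_bigr => y _; rewrite !linearZ fm.
Qed.

Lemma free_lift_delta M (m : T -> M) : exists h : {linear K -> M},
  (forall x s, supported_in (i x) s -> h x = \sum_(y <- undup s) (i x y : A) *: m y)
  /\ forall y, h (d y) = m y.
Proof.
have [h hP] := free_lift m; exists h; split=> // y.
rewrite (hP _ [:: y]) /= ?big_seq1 ?dP ?eqxx ?scale1r //.
by move=> z; rewrite inE => /negPf ->.
Qed.

End FinitelySupported.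

Lemma enough_projectives M :
  exists P (p : {linear P -> M}), projective P /\ surjective p.
Proof.
have [K [i [d [ii iP dP]]]] := free_exists M.
have [h [_ hP]] := free_lift_delta iP dP (fun x : M => x).
exists K, h; split; first exact: free_projective ii iP dP.
by move=> y; exists (d y).
Qed.

(** P is a retract of the free module on its own elements, and finitely many u_l involve only
    finitely many coordinates there. Fixing the family u first is what allows P to be infinitely
    generated. *)
Lemma dual_basis P n (u : 'I_n -> P) : projective P ->
  exists k (p : 'I_k -> P) (phi : 'I_k -> {linear P -> A^o}),
    forall l, u l = \sum_j (phi j (u l) : A) *: p j.
Proof.
move=> Pp; have [K [i [d [ii iP dP]]]] := free_exists P.
have [h [hP hd]] := free_lift_delta iP dP (fun x : P => x).
have hs : surjective h by move=> y; exists (d y).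
have [s hsK] := Pp _ _ h idfun hs.
have /choice[t tP] l := iP (s (u l)).
pose r := undup (flatten [seq t l | l <- enum 'I_n]).
have phiL j : linear (fun x => i (s x) (nth 0 r j) : A^o).
  by move=> a x y; rewrite !linearP.
(* The generators are the elements of P in the supports of the lifted u_l; the functionals are the
   matching coordinates of the section [s]. *)
exists (size r), (fun j => nth 0 r j), (fun j => mklinear (phiL j)) => l.
rewrite -[LHS]hsK (hP _ (flatten [seq t l | l <- enum 'I_n])).
  by rewrite (big_nth 0) big_mkord.
move=> x; apply: contraNeq => ix; apply/flattenP; exists (t l).
  by apply: map_f; rewrite mem_enum.
by apply: contraNT ix => /tP ->.
Qed.

End FreeModules.

(** * Maximal submodules and Noetherian modules *)

Section Finiteness.
Variable A : pzRingType.
Implicit Types (C K M N P Q S X Y : lmodType A).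

(** Zorn's lemma above U for any property G that passes to unions of nonempty chains. *)
Lemma maximal_submodule M (U : M -> Prop) (G : (M -> Prop) -> Prop) :
  submodule U -> G U ->
  (forall F : (M -> Prop) -> Prop, (exists V, F V) ->
    (forall V, F V -> G V) ->
    (forall V W, F V -> F W ->
      (forall x, V x -> W x) \/ (forall x, W x -> V x)) ->
    G (fun x => exists V, F V /\ V x)) ->
  exists Z : M -> Prop, [/\ submodule Z, forall x, U x -> Z x, G Z &
    forall Z', submodule Z' -> (forall x, Z x -> Z' x) -> G Z' ->
      forall x, Z' x -> Z x].
Proof.
(* Adjoining U to every set makes the empty set represent U, so the empty chain, which [Zorn_bigcup]
   also allows, causes no trouble. *)
move=> sU GU chG; pose up (X : set M) : M -> Prop := fun x => U x \/ X x.
pose good (X : set M) := submodule (up X) /\ G (up X).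
have [|Z [[sZ GZ] Zmax]] := @Zorn_bigcup M good.
  move=> F FP Ftot; pose F' V := exists2 X : set M, (F X \/ X = set0) & V = up X.
  have upF : up (\bigcup_(X in F) X)%classic = (fun x => exists V, F' V /\ V x).
    apply: funext => x; apply: propext.
    split=> [[Ux|[X FX Xx]]|[_ [[X FX ->] [Ux|Xx]]]].
    - by exists (up set0); split; [exists set0 => //; right | left].
    - by exists (up X); split; [exists X => //; left | right].
    - by left.
    - by case: FX Xx => [FX Xx|->//]; right; exists X.
  have F'ch V W : F' V -> F' W ->
      (forall x, V x -> W x) \/ (forall x, W x -> V x).
    move=> [X FX ->] [Y FY ->].
    case: FX => [FX|->]; last by left=> x [Ux|//]; left.
    case: FY => [FY|->]; last by right=> x [Ux|//]; left.
    by case: (Ftot _ _ FX FY) => XY; [left|right] => x [?|/XY ?];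
      by [left|right].
  have up0 : up set0 = U.
    by apply: funext => x; apply: propext; split=> [[]|] //; left.
  have F'g V : F' V -> submodule V /\ G V.
    by move=> [X [FX ->|-> ->]]; [exact: FP | rewrite up0].
  have F'n : exists V, F' V by exists (up set0); exists set0 => //; right.
  split; rewrite upF; last first.
    by apply: chG => // V /F'g[].
  split=> [|a u v [V [FV Vu]] [W [FW Ww]]].
    by exists (up set0); split; [exists set0 => //; right|left; case: sU].
  case: (F'ch _ _ FV FW) => VW; [exists W|exists V]; split=> //.
    by have [[_ WL] _] := F'g _ FW; apply: WL => //; apply: VW.
  by have [[_ WL] _] := F'g _ FV; apply: WL => //; apply: VW.
exists (up Z); split=> // [x Ux|Z' sZ' ZZ' GZ' x Z'x]; first by left.
apply: contrapT => nZx; apply: (Zmax Z').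
  split=> [y Zy|Z'Z]; first by apply: ZZ'; right.
  by apply: nZx; right; apply: Z'Z.
rewrite /good; have -> : up Z' = Z' => //.
by apply: funext => y; apply: propext; split=> [[Uy|]//|]; [apply: ZZ'; left|right].
Qed.

(** Being proper means missing one of finitely many basis vectors, and this survives unions of
    chains. *)
Lemma maximal_proper_row k (U : 'rV[A]_k -> Prop) : submodule U ->
  (exists c, ~ U c) ->
  exists Z : 'rV[A]_k -> Prop, [/\ submodule Z, forall x, U x -> Z x,
    (exists c, ~ Z c) &
    forall Z', submodule Z' -> (forall x, Z x -> Z' x) -> (exists c, ~ Z' c) ->
      forall x, Z' x -> Z x].
Proof.
have full (Z : 'rV[A]_k -> Prop) :
    submodule Z -> (forall j, Z (delta_mx 0 j)) -> forall x, Z x.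
  move=> sZ Ze x; rewrite [x]row_sum_delta; apply: submodule_sum => // i.
  exact: submoduleZ.
move=> sU [c Uc].
pose G (Z : 'rV[A]_k -> Prop) := ~ forall j, Z (delta_mx 0 j).
have [|F [V0 FV0] FG Fch Fall|Z [sZ UZ GZ Zmax]] := @maximal_submodule _ U G sU.
- by move=> /(full U sU)/(_ c).
- have [V FV Ve] : exists2 V, F V & forall j, j \in enum 'I_k -> V (delta_mx 0 j).
    elim: (enum 'I_k) => [|i s [V FV Vs]]; first by exists V0.
    have [W [FW We]] := Fall i.
    case: (Fch V W FV FW) => VW; [exists W|exists V] => // j;
      rewrite inE => /orP[/eqP ->|/Vs ?] //; exact: VW.
  by apply: (FG V FV) => j; apply: Ve; rewrite mem_enum.
exists Z; split=> // [|Z' sZ' ZZ' [d Zd]].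
  by apply: contrapT => nZ; apply: GZ => j; apply: contrapT => ?;
    apply: nZ; eexists; eassumption.
by apply: Zmax => // /(full Z' sZ')/(_ d).
Qed.

Lemma simple_quotient M S (U : M -> Prop) (p : {linear M -> S}) :
  surjective p -> (forall x, p x = 0 <-> U x) -> (exists c, ~ U c) ->
  (forall Z', submodule Z' -> (forall x, U x -> Z' x) -> (exists c, ~ Z' c) ->
    forall x, Z' x -> U x) ->
  simple_module S.
Proof.
move=> ps pU [c Uc] Umax; split; first by exists (p c); apply/eqP => /pU.
move=> V [V0 VL]; have [VT|nVT] := pselect (forall x, x \in V); first by right.
left=> y Vy; have [x xy] := ps y; rewrite -xy; apply/pU.
apply: (Umax (fun x => p x \in V)); last by rewrite xy.
- split=> [|a u v Vu Vv]; first by rewrite linear0.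
  by rewrite linearP; apply: VL.
- by move=> z /pU ->.
- apply: contrapT => nV; apply: nVT => z; have [w <-] := ps z.
  by apply: contrapT => ?; apply: nV; exists w.
Qed.

Definition generated M (s : seq M) (x : M) : Prop :=
  forall V : M -> Prop, submodule V -> (forall y, y \in s -> V y) -> V x.

Lemma generated_submodule M (s : seq M) : submodule (generated s).
Proof.
split=> [V [V0 _] _ //|a u v su sv V sV Vs].
by case: (sV) => _; apply; [apply: su|apply: sv].
Qed.

Lemma generated_mem M (s : seq M) x : x \in s -> generated s x.
Proof. by move=> xs V _; apply. Qed.

Lemma generated_sub M (s t : seq M) x :
  (forall y, y \in s -> generated t y) -> generated s x -> generated t x.
Proof. by move=> st; apply=> //; apply: generated_submodule. Qed.

Lemma generated_row M (s : seq M) x : generated s x ->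
  exists c, row_comb (fun i : 'I_(size s) => nth 0 s i) c = x.
Proof.
move=> /(_ _ (image_submodule (row_comb _))); apply=> y ys;
   have sy : (index y s < size s)%N by rewrite index_mem.
by exists (delta_mx 0 (Ordinal sy)); rewrite row_comb_delta nth_index.
Qed.

Lemma generated_cons M (s : seq M) x y :
  generated (x :: s) y -> exists a g, generated s g /\ y = a *: x + g.
Proof.
move=> /(_ (fun y => exists a g, generated s g /\ y = a *: x + g)); apply.
  have sg := @generated_submodule _ s.
  split=> [|c u v [a [g [sg1 ->]]] [a' [g' [sg2 ->]]]].
    by exists 0, 0; rewrite scale0r addr0; split=> //; exact: (proj1 sg).
  exists (c * a + a'), (c *: g + g'); split; first exact: (proj2 sg).
  by rewrite scalerDr scalerDl addrACA scalerA.
move=> z; rewrite inE => /orP[/eqP ->|zs].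
  by exists 1, 0; rewrite scale1r addr0; split=> //;
    exact: (proj1 (generated_submodule s)).
by exists 0, z; rewrite scale0r add0r; split=> //; exact: generated_mem.
Qed.

Definition fg_submodule M (U : M -> Prop) : Prop :=
  exists s : seq M, (forall y, y \in s -> U y) /\ forall x, U x -> generated s x.

Lemma fg_submodule_image M (U : M -> Prop) : submodule U -> fg_submodule U ->
  exists n (f : {linear 'rV[A]_n -> M}), forall x, U x <-> exists c, f c = x.
Proof.
move=> sU [s [Us sUx]]; exists (size s), (row_comb (fun i => nth 0 s i)) => x.
split=> [/sUx/generated_row //|[c <-]]; rewrite row_combE.
by apply: submodule_sum => // i; apply: submoduleZ => //; apply/Us/mem_nth.
Qed.

(** Lifts of generators of f(U), together with generators of the kernel of f on U, generate U. *)
Lemma fg_submodule_ext M N (f : {linear M -> N}) (U : M -> Prop) :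
  submodule U -> fg_submodule (fun y => exists2 x, U x & f x = y) ->
  fg_submodule (fun x => U x /\ f x = 0) -> fg_submodule U.
Proof.
move=> sU [s1 [Us1 s1U]] [s2 [Us2 s2U]].
have [t [tU ts]] : exists t : seq M, (forall y, y \in t -> U y) /\
    forall y, y \in s1 -> exists2 x, x \in t & f x = y.
  elim: s1 Us1 {s1U} => [|y s IH] Us1; first by exists [::].
  have [|t [tU ts]] := IH; first by move=> z zs; apply: Us1; rewrite inE zs orbT.
  have [x Ux xy] := Us1 y (mem_head _ _); exists (x :: t); split=> z.
    by rewrite inE => /orP[/eqP ->|/tU].
  rewrite inE => /orP[/eqP ->|/ts[w wt <-]]; first by exists x; rewrite ?mem_head.
  by exists w; rewrite // inE wt orbT.
exists (t ++ s2); split=> [y|x Ux].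
  by rewrite mem_cat => /orP[/tU|/Us2[]].
have sg := generated_submodule (t ++ s2).
have [|||x' [gx' fx']] := s1U (f x) _
    (fun y => exists x, generated (t ++ s2) x /\ f x = y).
- by exists x.
- split=> [|a _ _ [u [gu <-]] [v [gv <-]]].
    by exists 0; rewrite linear0; split=> //; case: sg.
  by exists (a *: u + v); rewrite linearP; split=> //; case: sg => _; apply.
- move=> y /ts[w wt <-]; exists w; split=> //.
  by apply: generated_mem; rewrite mem_cat wt.
have Ux' : U x'.
  by apply: gx' => // y; rewrite mem_cat => /orP[/tU|/Us2[]].
rewrite -[x](subrK x'); apply: (submoduleD sg) => //.
apply: (@generated_sub _ s2).
  by move=> y ys; apply: generated_mem; rewrite mem_cat ys orbT.
by apply: s2U; split; [apply: submoduleB | rewrite linearB fx' subrr].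
Qed.

Hypothesis noethA : left_noetherian A.

Lemma noetherian_ideal_fg (U : A^o -> Prop) : submodule U -> fg_submodule U.
Proof.
move=> sU; apply: contrapT => nfg.
have /choice[nxt nxtP] (s : seq A^o) :
    exists x, (forall y, y \in s -> U y) -> U x /\ ~ generated s x.
  have [Us|nUs] := pselect (forall y, y \in s -> U y); last by exists 0.
  apply: contrapT => nx; apply: nfg; exists s; split=> // x Ux.
  by apply: contrapT => gx; apply: nx; exists x.
pose s n := iter n (fun s => nxt s :: s) [::].
have sU' n : forall y, y \in s n -> U y.
  elim: n => [|n IH] y //=; rewrite inE => /orP[/eqP ->|/IH//].
  by case: (nxtP _ IH).
have [n|n x /submodule_predE g|n nP] :=
    noethA (I := fun n => submodule_pred (generated (s n))).
- exact/submodule_closed/generated_submodule.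
- apply/submodule_predE; apply: generated_sub g => y ys.
  by apply: generated_mem; rewrite inE ys orbT.
have [_ []] := nxtP (s n) (@sU' n).
apply: (iffLR (submodule_predE _ _)).
rewrite -(nP n.+1 (leqnSn n)); apply: (iffRL (submodule_predE _ _)).
by apply: generated_mem; apply: mem_head.
Qed.

(** Induction on the number of coordinates allowed to be nonzero: the k-th coordinate maps [V k.+1]
    onto a left ideal, with kernel [V k]. *)
Lemma noetherian_row_fg n (U : 'rV[A]_n -> Prop) : submodule U -> fg_submodule U.
Proof.
move=> sU.
pose V k (x : 'rV[A]_n) := U x /\ forall i : 'I_n, (k <= i)%N -> x 0 i = 0.
have sV k : submodule (V k).
  split=> [|a u v [Uu u0] [Uv v0]].
    by split=> [|i _]; [case: sU|rewrite mxE].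
  split=> [|i ki]; first by case: sU => _; apply.
  by rewrite !mxE u0 // v0 // mulr0 addr0.
suff /(_ n)[s [Us sUs]] : forall k, fg_submodule (V k).
  exists s; split=> [y /Us[]//|x Ux]; apply: sUs; split=> // i.
  by rewrite leqNgt ltn_ord.
elim=> [|k IH].
  exists [::]; split=> // x [Ux x0].
  have -> : x = 0 by apply/rowP => i; rewrite x0 ?mxE.
  exact: (proj1 (generated_submodule [::])).
have [kn|nk] := ltnP k n; last first.
  case: IH => s [Vs sV']; exists s; split=> [y /Vs[Uy y0]|x [Ux _]].
    by split=> // i ki; apply/y0/ltnW.
  apply: sV'; split=> // i ki.
  by have := leq_trans nk ki; rewrite leqNgt ltn_ord.
have cL : linear (fun x : 'rV[A]_n => x 0 (Ordinal kn) : A^o).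
  by move=> a u v; rewrite !mxE.
apply: (@fg_submodule_ext _ _ (mklinear cL)) => //.
  apply: noetherian_ideal_fg; split=> [|a _ _ [u Vu <-] [v Vv <-]].
    by exists 0; [case: (sV k.+1)|rewrite linear0].
  by exists (a *: u + v); [case: (sV k.+1) => _; apply|rewrite linearP].
case: IH => s [Vs sV']; exists s; split=> [y /Vs[Uy y0]|x [[Ux x0] xk]].
  by split; [split=> // i /ltnW; apply: y0|apply: y0].
apply: sV'; split=> // i; rewrite leq_eqVlt => /orP[/eqP ki|]; last exact: x0.
by rewrite -[RHS]xk; congr (x 0 _); apply: val_inj.
Qed.

Lemma noetherian_fg M (U : M -> Prop) :
  finitely_generated M -> submodule U -> fg_submodule U.
Proof.
move=> [n [f fs]] sU.
have sV : submodule (fun c => U (f c)).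
  by split=> [|a u v Uu Uv]; rewrite ?linear0 ?linearP; case: sU => // _; apply.
have [s [Us sUs]] := noetherian_row_fg sV.
exists (map f s); split=> [_ /mapP[c cs ->]|x]; first exact: Us.
have [c <-] := fs x => /sUs/(_ (fun d => generated (map f s) (f d))).
apply=> [|d ds].
  have sg := @generated_submodule _ (map f s).
  by split=> [|a u v gu gv]; rewrite ?linear0 ?linearP; case: sg => // _; apply.
by apply: generated_mem; apply: map_f.
Qed.

Lemma noetherian_kernel n X (f : {linear 'rV[A]_n -> X}) :
  exists m (g : {linear 'rV[A]_m -> 'rV[A]_n}), exact_at g f.
Proof.
have sk := kernel_submodule f.
exact: fg_submodule_image sk (noetherian_row_fg sk).
Qed.

Lemma noetherian_fp X : finitely_generated X -> finitely_presented X.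
Proof.
move=> [n [f fs]]; have [m [g gf]] := noetherian_kernel f.
by exists m, n, g, f.
Qed.

Lemma noetherian_sub_fg K M (i : {linear K -> M}) : injective i ->
  finitely_generated M -> finitely_generated K.
Proof.
move=> ii fgM; have si := image_submodule i.
have [n [f fP]] := fg_submodule_image si (noetherian_fg fgM si).
have [|g ig] := @factor_injective _ _ _ _ i f ii.
  by move=> c; apply/fP; exists c.
exists n, g => y; have [c fc] : exists c, f c = i y by apply/fP; exists y.
by exists c; apply: ii; rewrite ig.
Qed.

End Finiteness.

Lemma fp_fg (A : pzRingType) (M : lmodType A) :
  finitely_presented M -> finitely_generated M.
Proof. by move=> [m [n [g [f [fs _]]]]]; exists n, f. Qed.

(** * Projective dimension *)

Section ProjectiveDimension.
Variable A : pzRingType.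
Implicit Types (C K M N P Q S X Y : lmodType A).

(* Unlike [stable_retract], the projective module through which the           *)
(* difference factors need not be finitely presented.                         *)
Definition big_stable_retract X Y : Prop :=
  exists (s : {linear X -> Y}) (r : {linear Y -> X}) P (a : {linear X -> P})
    (b : {linear P -> X}),
    projective P /\ forall x, r (s x) - x = b (a x).

Lemma stable_retract_big X Y : stable_retract X Y -> big_stable_retract X Y.
Proof. by move=> [s [r [P [a [b [_ Pp ab]]]]]]; exists s, r, P, a, b. Qed.

Lemma big_stable_retract_refl X : big_stable_retract X X.
Proof.
exists idfun, idfun, 'rV[A]_0, \0, \0; split; first exact: row_projective.
by move=> x /=; rewrite subrr.
Qed.

(** Schanuel's argument. Lift s, r and b to maps s0, r0, h into the projective covers; then r0 s0 -
    1 - h a p takes its values in K, and restricting it to K shows that r1 s1 - 1 factors through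
    P. *)
Lemma syzygy_stable_retract X Y K K' P P' (i : {linear K -> P})
    (p : {linear P -> X}) (i' : {linear K' -> P'}) (p' : {linear P' -> Y}) :
  big_stable_retract X Y -> projective P -> projective P' ->
  ses i p -> ses i' p' -> big_stable_retract K K'.
Proof.
move=> [s [r [Q [a [b [Qp rs]]]]]] Pp Pp' [ii ps ip] [ii' ps' ip'].
have [s0 s0P] := Pp _ _ p' (s \o p) ps'.
have [r0 r0P] := Pp' _ _ p (r \o p') ps.
have [h hP] := Qp _ _ p b ps.
have [|s1 s1P] := @factor_injective _ _ _ _ i' (s0 \o i) ii'.
  by move=> x; apply/ip'; rewrite /= s0P /= (exact_comp0 _ ip) linear0.
have [|r1 r1P] := @factor_injective _ _ _ _ i (r0 \o i') ii.
  by move=> x; apply/ip; rewrite /= r0P /= (exact_comp0 _ ip') linear0.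
have [t tP] : exists t : {linear P -> P},
    forall x, t x = r0 (s0 x) - x - h (a (p x)).
  by exists ((r0 \o s0) \- idfun \- (h \o (a \o p))).
have [k kP] : exists k : {linear P -> K}, forall x, i (k x) = t x.
  apply: factor_injective => // x; apply/ip.
  by rewrite tP !linearB /= r0P /= s0P /= hP rs subrr.
exists s1, r1, P, i, k; split=> // x; apply: ii.
rewrite linearB r1P /= s1P /= kP tP (exact_comp0 _ ip) !linear0.
by rewrite addr0.
Qed.

Lemma projective_lift_exact P M N X (f : {linear M -> N}) (g : {linear N -> X})
    (h : {linear P -> N}) :
  projective P -> exact_at f g -> (forall x, g (h x) = 0) ->
  exists k : {linear P -> M}, forall x, f (k x) = h x.
Proof.
move=> Pp fg gh; have [K [i [ii iP]]] := submodule_exists (image_submodule f).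
have [|f' f'P] := @factor_injective _ _ _ _ i f ii.
  by move=> x; apply/iP; exists x.
have [|h' h'P] := @factor_injective _ _ _ _ i h ii.
  by move=> x; apply/iP/fg.
have [|k kP] := Pp _ _ f' h'.
  move=> y; have [x xy] : exists x, f x = i y by apply/iP; exists y.
  by exists x; apply: ii; rewrite f'P.
by exists k => x; rewrite -f'P kP h'P.
Qed.

Lemma big_stable_retract_projective X Y :
  big_stable_retract X Y -> projective Y -> projective X.
Proof.
move=> [s [r [P [a [b [Pp rs]]]]]] Yp M N f g fs.
have [h1 h1P] := Yp _ _ f (g \o r) fs.
have [h2 h2P] := Pp _ _ f (g \o b) fs.
have [h hP] : exists h : {linear X -> M}, forall x, h x = h1 (s x) - h2 (a x).
  by exists ((h1 \o s) \- (h2 \o a)).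
exists h => x; rewrite hP linearB h1P h2P /= -linearB -rs.
by rewrite opprB addrC subrK.
Qed.

Fixpoint pd_le n M : Prop :=
  match n with
  | 0%N => projective M
  | k.+1 => exists P K (i : {linear K -> P}) (p : {linear P -> M}),
      [/\ projective P, ses i p & pd_le k K]
  end.

(** Stated for retracts because syzygies are unique only up to stable retracts; the induction may
    then choose any cover of X. *)
Lemma pd_le_stable_retract n X Y :
  big_stable_retract X Y -> pd_le n Y -> pd_le n X.
Proof.
elim: n X Y => [|n IH] X Y XY; first exact: big_stable_retract_projective.
move=> [P' [K' [i' [p' [Pp' ip' K'n]]]]].
have [P [p [Pp ps]]] := enough_projectives X.
have [K [i ip]] := kernel_ses ps.
exists P, K, i, p; split=> //; apply: IH K'n.
exact: syzygy_stable_retract XY Pp Pp' ip ip'.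
Qed.

Lemma pd_le_syzygy n M P K (i : {linear K -> P}) (p : {linear P -> M}) :
  pd_le n.+1 M -> projective P -> ses i p -> pd_le n K.
Proof.
move=> [P' [K' [i' [p' [Pp' ip' K'n]]]]] Pp ip.
apply: pd_le_stable_retract K'n.
exact: syzygy_stable_retract (big_stable_retract_refl M) Pp Pp' ip ip'.
Qed.

(** Dropping the term in degree 0 leaves a resolution of the kernel of the augmentation. *)
Lemma resolution_pd_le n M (F : resolution M) :
  (forall i, (n < i)%N -> forall x : res_obj F i, x = 0) -> pd_le n M.
Proof.
elim: n M F => [|n IH] M F F0.
  have inj x : res_aug F x = 0 -> x = 0.
    by move=> /(@res_exact0 _ _ F)[y <-]; rewrite [y]F0 // linear0.
  have [g gP] := factor_surjective (h := idfun) (@res_aug_surj _ _ F) inj.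
  apply: (@projective_retract _ _ _ g (res_aug F)); last exact: res_projective.
  by move=> y; have [x <-] := @res_aug_surj _ _ F y; rewrite gP.
have [K [i ip]] := kernel_ses (@res_aug_surj _ _ F); have [ii ps ex] := ip.
have [|g gP] := @factor_injective _ _ _ _ i (res_diff F 0) ii.
  by move=> x; apply/ex/res_exact0; exists x.
exists (res_obj F 0), K, i, (res_aug F); split=> //; first exact: res_projective.
have gs : surjective g.
  move=> k; have [x xk] : exists x, res_diff F 0 x = i k.
    by apply/res_exact0/ex; exists k.
  by exists x; apply: ii; rewrite gP.
have ge : exact_at (res_diff F 1) g.
  move=> y; split=> [gy|[x <-]].
    by apply/(@res_exactS _ _ F _); rewrite -gP gy linear0.
  by apply: ii; rewrite gP linear0; apply/(@res_exactS _ _ F _); exists x.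
pose G := @Resolution _ K (fun i => res_obj F i.+1) (fun i => res_diff F i.+1)
  g (fun i => @res_projective _ _ F i.+1) gs ge (fun i => @res_exactS _ _ F i.+1).
by apply: (IH K G) => j nj; apply: F0.
Qed.

Lemma pd_le_resolution n M : pd_le n M -> exists F : resolution M,
  forall i, (n < i)%N -> forall x : res_obj F i, x = 0.
Proof.
have row0 (x : 'rV[A]_0) : x = 0 by apply/rowP => -[].
elim: n M => [|n IH] M.
  move=> Mp.
  pose obj i := if i is 0%N then M else ('rV[A]_0 : lmodType A).
  pose d i : {linear obj i.+1 -> obj i} := \0.
  unshelve eexists (@Resolution _ M obj d (idfun : {linear obj 0%N -> M}) _ _ _ _).
  - by case=> [|i] //; apply: row_projective.
  - by move=> y; exists y.
  - by move=> y; split=> [/= ->|[x <-]//]; exists 0.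
  - by move=> i y; split=> [_|[x <-]//]; exists 0; rewrite linear0 [y]row0.
  - by case.
move=> [P [K [i [p [Pp [ii ps ip] /IH[F F0]]]]]].
pose obj j := if j is k.+1 then res_obj F k else P.
pose d j : {linear obj j.+1 -> obj j} :=
  match j with 0%N => i \o res_aug F | k.+1 => res_diff F k end.
unshelve eexists (@Resolution _ M obj d (p : {linear obj 0%N -> M}) _ ps _ _).
- by case=> [|j] //; apply: res_projective.
- move=> y; rewrite ip; split=> [[k <-]|[x <-]]; last by exists (res_aug F x).
  by have [x <-] := @res_aug_surj _ _ F k; exists x.
- move=> [|j] y; last exact: res_exactS.
  split=> [/= y0|[x <-]].
    by apply/(@res_exact0 _ _ F)/ii; rewrite y0 linear0.
  by rewrite /= (exact_comp0 _ (@res_exact0 _ _ F)) linear0.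
by case=> // j; apply: F0.
Qed.

Lemma enat_infP (P : nat -> Prop) n : enat_inf P = Some n ->
  P n /\ forall m, P m -> (n <= m)%N.
Proof.
rewrite /enat_inf; case: pselect => // exP [<-].
by case: ex_minnP => m /asboolP Pm mmin; split=> // k Pk; apply/mmin/asboolP.
Qed.

Lemma enat_inf_le (P : nat -> Prop) n : P n -> enat_inf P <=oo Some n.
Proof.
rewrite /enat_inf; case: pselect => [exP Pn|nex Pn] /=.
  by case: ex_minnP => m _; apply; apply/asboolP.
by case: nex; exists n; apply/asboolP.
Qed.

Lemma projdim_le n M : projdim M <=oo Some n <-> pd_le n M.
Proof.
split=> [|/pd_le_resolution]; last exact: enat_inf_le.
rewrite /projdim; case E: (enat_inf _) => [m|//] /= mn.
have [[F F0] _] := enat_infP E; apply: (@resolution_pd_le n _ F) => i ni.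
by apply: F0; apply: leq_ltn_trans ni.
Qed.

End ProjectiveDimension.

(** * Vanishing of Tor *)

Section Tor.
Variable L : pzRingType.
Implicit Types (M N P Q : lmodType L) (X Y K : lmodType L^c).

(* The map [f (x) M : M^s -> M^r]: the (j, i) entry of the matrix of the map  *)
(* [f] of right modules acts on the left module M.                            *)
Definition act M s r (f : {linear 'rV[L^c]_s -> 'rV[L^c]_r}) (u : 'I_s -> M) :
    'I_r -> M :=
  fun j => \sum_i (f (delta_mx 0 i) 0 j : L) *: u i.

Lemma row_map_coord s r (f : {linear 'rV[L^c]_s -> 'rV[L^c]_r}) x j :
  f x 0 j = \sum_i (f (delta_mx 0 i) 0 j : L) * (x 0 i : L).
Proof. by rewrite linear_rowE summxE; apply: eq_bigr => i _; rewrite mxE. Qed.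

Lemma act_comp M s r t (f : {linear 'rV[L^c]_s -> 'rV[L^c]_r})
    (g : {linear 'rV[L^c]_r -> 'rV[L^c]_t})
    (h : {linear 'rV[L^c]_s -> 'rV[L^c]_t}) (u : 'I_s -> M) :
  (forall x, g (f x) = h x) -> act g (act f u) = act h u.
Proof.
move=> gf; apply: funext => k; rewrite /act.
under eq_bigr => j _ do rewrite scaler_sumr.
rewrite exchange_big; apply: eq_bigr => i _ /=.
rewrite -gf row_map_coord scaler_suml; apply: eq_bigr => j _.
by rewrite scalerA.
Qed.

Lemma actD_map M s r (f g h : {linear 'rV[L^c]_s -> 'rV[L^c]_r}) (u : 'I_s -> M) :
  (forall x, h x = f x + g x) -> act h u = act f u + act g u.
Proof.
move=> hfg; apply: funext => j; rewrite !fctE /act -big_split.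
by apply: eq_bigr => i _; rewrite hfg mxE scalerDl.
Qed.

Lemma act_id M s (u : 'I_s -> M) : act idfun u = u.
Proof.
apply: funext => j; rewrite /act (bigD1 j) //= mxE !eqxx scale1r.
rewrite big1 ?addr0 // => i ij.
by rewrite mxE eq_sym (negPf ij) andbF scale0r.
Qed.

Lemma act_map0 M s r (f : {linear 'rV[L^c]_s -> 'rV[L^c]_r}) (u : 'I_s -> M) :
  (forall x, f x = 0) -> act f u = 0.
Proof.
by move=> f0; apply: funext => j; rewrite /act big1 // => i _;
  rewrite f0 mxE scale0r.
Qed.

Lemma act_linear M N s r (f : {linear 'rV[L^c]_s -> 'rV[L^c]_r})
    (p : {linear M -> N}) (u : 'I_s -> M) : act f (p \o u) = p \o act f u.
Proof.
apply: funext => j; rewrite /act /= linear_sum.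
by apply: eq_bigr => i _; rewrite linearZ.
Qed.

Lemma actB M s r (f : {linear 'rV[L^c]_s -> 'rV[L^c]_r}) (u v : 'I_s -> M) :
  act f (u - v) = act f u - act f v.
Proof.
apply: funext => j; rewrite /act !fctE -sumrB.
by apply: eq_bigr => i _; rewrite -scalerBr.
Qed.

Lemma act0 M s r (f : {linear 'rV[L^c]_s -> 'rV[L^c]_r}) : act f (0 : 'I_s -> M) = 0.
Proof. by apply: funext => j; rewrite /act big1 // => i _; rewrite scaler0. Qed.

Lemma comp_surjective_lift M N n (p : {linear M -> N}) (u : 'I_n -> N) :
  surjective p -> exists v, p \o v = u.
Proof.
by move=> ps; have /choice[v vP] j := ps (u j); exists v; apply: funext.
Qed.

Lemma comp_exact_lift M N P n (i : {linear M -> N}) (p : {linear N -> P})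
    (w : 'I_n -> N) :
  exact_at i p -> p \o w = 0 -> exists v, i \o v = w.
Proof.
move=> ip pw; have /choice[v vP] j : exists x, i x = w j.
  by apply/ip; exact: (congr1 (fun f => f j) pw).
by exists v; apply: funext.
Qed.

Lemma comp_injective M N n (i : {linear M -> N}) (u v : 'I_n -> M) :
  injective i -> i \o u = i \o v -> u = v.
Proof.
by move=> ii uv; apply: funext => j; apply: ii; exact: (congr1 (fun f => f j) uv).
Qed.

Lemma comp_exact0 M N P n (i : {linear M -> N}) (p : {linear N -> P})
    (v : 'I_n -> M) : exact_at i p -> p \o (i \o v) = 0.
Proof. by move=> ip; apply: funext => j; exact: exact_comp0 ip. Qed.

Lemma comp_linearB M N n (q : {linear M -> N}) (u v : 'I_n -> M) :
  q \o (u - v) = (q \o u) - (q \o v).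
Proof. by apply: funext => j; exact: linearB. Qed.

Lemma comp_linear0 M N n (q : {linear M -> N}) : q \o (0 : 'I_n -> M) = 0.
Proof. by apply: funext => j; exact: linear0. Qed.

Lemma act_exact0 M t s r (c : {linear 'rV[L^c]_t -> 'rV[L^c]_s})
    (b : {linear 'rV[L^c]_s -> 'rV[L^c]_r}) (u : 'I_t -> M) :
  exact_at c b -> act b (act c u) = 0.
Proof.
move=> cb; rewrite (@act_comp _ _ _ _ _ _ (b \o c)) // act_map0 // => x /=.
exact: exact_comp0 cb.
Qed.

Definition act_exact M t s r (c : {linear 'rV[L^c]_t -> 'rV[L^c]_s})
    (b : {linear 'rV[L^c]_s -> 'rV[L^c]_r}) : Prop :=
  forall u : 'I_s -> M, act b u = 0 -> exists v, act c v = u.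

(* Tor_1(X, M) = 0, computed from free resolutions of X.                      *)
Definition tor1_zero X M : Prop :=
  forall t s r (c : {linear 'rV[L^c]_t -> 'rV[L^c]_s})
    (b : {linear 'rV[L^c]_s -> 'rV[L^c]_r}) (p : {linear 'rV[L^c]_r -> X}),
    surjective p -> exact_at b p -> exact_at c b -> act_exact M c b.

(** One free resolution of Y is compared with every free resolution of X by chain maps S, R and a
    homotopy k. With X = Y this gives independence of the resolution. *)
Lemma tor1_zero_stable X Y M t s r (c : {linear 'rV[L^c]_t -> 'rV[L^c]_s})
    (b : {linear 'rV[L^c]_s -> 'rV[L^c]_r}) (p : {linear 'rV[L^c]_r -> Y}) :
  surjective p -> exact_at b p -> exact_at c b -> act_exact M c b ->
  big_stable_retract X Y -> tor1_zero X M.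
Proof.
move=> ps bp cb cbM [sX [rX [Q [al [be [Qp rs]]]]]] t' s' r' c' b' p' ps' bp' cb'.
have rowP := @row_projective L^c.
have bp0 x := exact_comp0 x bp; have cb0 x := exact_comp0 x cb.
have bp0' x := exact_comp0 x bp'; have cb0' x := exact_comp0 x cb'.
have [S0 S0P] := rowP _ _ _ p (sX \o p') ps.
have [|S1 S1P] := projective_lift_exact (h := S0 \o b') (rowP _) bp.
  by move=> x /=; rewrite S0P /= bp0' linear0.
have [R0 R0P] := rowP _ _ _ p' (rX \o p) ps'.
have [|R1 R1P] := projective_lift_exact (h := R0 \o b) (rowP _) bp'.
  by move=> x /=; rewrite R0P /= bp0 linear0.
have [|R2 R2P] := projective_lift_exact (h := R1 \o c) (rowP _) cb'.
  by move=> x /=; rewrite R1P /= cb0 linear0.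
have [h hP] := Qp _ _ p' be ps'.
(* R0 S0 - 1 differs from a map into the kernel of p' by the lift h of the part that factors through
   Q; that term disappears in degree 1 because p' b' = 0. *)
have [|k0 k0P] := projective_lift_exact
    (h := (R0 \o S0) \- idfun \- (h \o (al \o p'))) (rowP _) bp'.
  by move=> x /=; rewrite !linearB /= R0P /= S0P /= hP rs subrr.
have [|k1 k1P] := projective_lift_exact
    (h := (R1 \o S1) \- idfun \- (k0 \o b')) (rowP _) cb'.
  move=> x /=; rewrite !linearB /= R1P /= S1P /= k0P /= bp0' !linear0.
  by rewrite addr0 subrr.
move=> u bu; have [|v cv] := cbM (act S1 u).
  by rewrite (@act_comp _ _ _ _ _ _ (S0 \o b')) //
    -(@act_comp _ _ _ _ b' S0) // bu act0.
have RSu : act R1 (act S1 u) = u + (act c' (act k1 u) + act k0 (act b' u)).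
  rewrite (@act_comp _ _ _ _ S1 R1 (R1 \o S1)) //.
  rewrite (@act_comp _ _ _ _ k1 c' (c' \o k1)) //.
  rewrite (@act_comp _ _ _ _ b' k0 (k0 \o b')) //.
  rewrite -(@actD_map _ _ _ _ _ ((c' \o k1) \+ (k0 \o b'))) //.
  rewrite -{2}[u]act_id -(@actD_map _ _ _ _ _ (R1 \o S1)) // => x /=.
  by rewrite k1P /= subrK addrC subrK.
exists (act R2 v - act k1 u); rewrite actB.
have -> : act c' (act R2 v) = act R1 (act S1 u).
  by rewrite -cv (@act_comp _ _ _ _ c R1 (R1 \o c)) //; apply: act_comp.
by rewrite RSu bu act0 addr0 addrK.
Qed.

(** Projectives are flat: in a dual basis of u, each row of coefficients is killed by b, hence comes
    from c, and the lifted rows recombine to a preimage of u. *)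
Lemma tor1_zero_projective X P : projective P -> tor1_zero X P.
Proof.
move=> Pp t s r c b p ps bp cb u bu.
have [k [q [phi uE]]] := dual_basis u Pp.
have /choice[y yP] j : exists y, c y = \row_i (phi j (u i) : L^c).
  apply/cb/rowP => l; rewrite row_map_coord mxE.
  have := congr1 (fun w => w l) (act_linear b (phi j) u).
  rewrite bu /= linear0 => H; rewrite -[RHS]H /act.
  by apply: eq_bigr => i _; rewrite mxE.
exists (fun l => \sum_j (y j 0 l : L) *: q j).
apply: funext => i; rewrite uE /act.
under eq_bigr => l _ do rewrite scaler_sumr.
rewrite exchange_big; apply: eq_bigr => j _ /=.
have := congr1 (fun w : 'rV_s => w 0 i : L) (yP j); rewrite mxE => <-.
rewrite row_map_coord scaler_suml; apply: eq_bigr => l _.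
by rewrite scalerA.
Qed.

Hypothesis noethL : left_noetherian L^c.

(** Both conditions say Tor_2(X, M) = 0. On one free resolution of X, the two directions are the
    diagram chases of the connecting map for M' -> Q -> M. *)
Lemma tor1_zero_shift X K (P : lmodType L^c) (i : {linear K -> P})
    (p : {linear P -> X}) M M' Q (i' : {linear M' -> Q}) (p' : {linear Q -> M}) :
  finitely_generated X -> finitely_generated K -> projective P -> ses i p ->
  projective Q -> ses i' p' -> tor1_zero K M <-> tor1_zero X M'.
Proof.
move=> [n0 [e es]] [m0 [f fs]] Pp ip Qp [ii' ps' ip'].
have [n1 [d0 d0e]] := noetherian_kernel noethL e.
have [n2 [d1 d1d0]] := noetherian_kernel noethL d0.
have [n3 [d2 d2d1]] := noetherian_kernel noethL d1.
have [K0 [i0 ip0]] := kernel_ses es; have [ii0 _ ie0] := ip0.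
have [|e1 e1P] := @factor_injective _ _ _ _ i0 d0 ii0.
  by move=> x; apply/ie0/d0e; exists x.
have e1s : surjective e1.
  move=> y; have [x xy] : exists x, d0 x = i0 y by apply/d0e/ie0; exists y.
  by exists x; apply: ii0; rewrite e1P.
have d1e1 : exact_at d1 e1.
  move=> x; rewrite -d1d0 -e1P; split=> [->|?]; first exact: linear0.
  by apply: ii0; rewrite linear0.
(* K and the kernel K0 of the free cover are syzygies of the same X, hence stable retracts of each
   other. *)
have K0K : tor1_zero K M <-> act_exact M d2 d1.
  have KK0 := syzygy_stable_retract (big_stable_retract_refl X).
  split=> [tK|]; last first.
    move=> ex; apply: (tor1_zero_stable e1s d1e1 d2d1 ex).
    exact: KK0 Pp (@row_projective _ _) ip ip0.
  have [m1 [f1 f1e]] := noetherian_kernel noethL f.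
  have [m2 [f2 f2e]] := noetherian_kernel noethL f1.
  have tK0 : tor1_zero K0 M.
    apply: (tor1_zero_stable fs f1e f2e (tK _ _ _ _ _ _ fs f1e f2e)).
    exact: KK0 (@row_projective _ _) Pp ip0 ip.
  exact: tK0 e1s d1e1 d2d1.
have XX : tor1_zero X M' <-> act_exact M' d1 d0.
  split=> [tX|ex]; first exact: tX es d0e d1d0.
  exact: tor1_zero_stable es d0e d1d0 ex (big_stable_retract_refl X).
have act_dd1 N (u : 'I_n3 -> N) := act_exact0 u d2d1.
have act_dd0 N (u : 'I_n2 -> N) := act_exact0 u d1d0.
have exQ2 : act_exact Q d2 d1 := tor1_zero_projective Qp e1s d1e1 d2d1.
have exQ1 : act_exact Q d1 d0 := tor1_zero_projective Qp es d0e d1d0.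
rewrite K0K XX; split=> ex u du.
- have [|w wu] := exQ1 (i' \o u); first by rewrite act_linear du comp_linear0.
  have [|z zw] := ex (p' \o w); first by rewrite act_linear wu (comp_exact0 _ ip').
  have [z' z'z] := comp_surjective_lift z ps'.
  have [|w' w'w] := comp_exact_lift (w := w - act d2 z') ip'.
    by rewrite comp_linearB -act_linear z'z zw subrr.
  by exists w'; apply: (comp_injective ii');
    rewrite -act_linear w'w actB act_dd1 subr0.
- have [u' u'u] := comp_surjective_lift u ps'.
  have [|v vu] := comp_exact_lift (w := act d1 u') ip'.
    by rewrite -act_linear u'u.
  have [|w wv] := ex v.
    by apply: (comp_injective ii'); rewrite -act_linear vu act_dd0 comp_linear0.
  have [|z zw] := exQ2 (u' - (i' \o w)).
    by rewrite actB act_linear wv vu subrr.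
  by exists (p' \o z); rewrite act_linear zw comp_linearB (comp_exact0 _ ip') subr0.
Qed.

End Tor.

(** * Dual resolutions and the depth *)

Section FreeResolution.
Variables (A : pzRingType) (noethA : left_noetherian A).

(** Bundling a map with its ranks gives a single type on which taking kernels can be iterated. *)
Record row_map := RowMap {
  row_tgt : nat; row_src : nat; row_mor : {linear 'rV[A]_row_src -> 'rV[A]_row_tgt}
}.

Lemma row_map_kernel (f : row_map) :
  {g : {k : nat & {linear 'rV[A]_k -> 'rV[A]_(row_src f)}}
     | exact_at (projT2 g) (row_mor f)}.
Proof.
by apply: cid; have [k [g gf]] := noetherian_kernel noethA (row_mor f);
  exists (existT _ k g).
Qed.

Definition next_row_map (f : row_map) : row_map :=
  RowMap (projT2 (sval (row_map_kernel f))).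

Lemma free_resolution M : finitely_generated M ->
  exists (n : nat -> nat) (d : forall i, {linear 'rV[A]_(n i.+1) -> 'rV[A]_(n i)})
    (e : {linear 'rV[A]_(n 0) -> M}),
    [/\ surjective e, exact_at (d 0) e & forall i, exact_at (d i.+1) (d i)].
Proof.
move=> [n0 [e es]]; have [n1 [d0 d0e]] := noetherian_kernel noethA e.
pose st i := iter i next_row_map (RowMap d0).
exists (fun i => row_tgt (st i)), (fun i => row_mor (st i)), e; split=> // i.
exact: (svalP (row_map_kernel (st i))).
Qed.

End FreeResolution.

Section Dual.
Variable L : pzRingType.

(** These forms identify Hom(L^n, L) for right modules with the left module L^n. Under this
    identification [row_dual] is Hom(f, L), and Ext(S, L) is the cohomology of the maps
    [row_dual (d i)]. *)
Definition row_form n (y : 'rV[L]_n) : {linear 'rV[L^c]_n -> (L^c)^o} :=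
  row_comb (fun j => y 0 j : (L^c)^o).

Lemma row_form_delta n (y : 'rV[L]_n) i : row_form y (delta_mx 0 i) = y 0 i.
Proof. exact: row_comb_delta. Qed.

Lemma row_formE n (y : 'rV[L]_n) x :
  row_form y x = \sum_j y 0 j * (x 0 j : L) :> L.
Proof. by []. Qed.

Lemma row_form_coord n j x : row_form (delta_mx 0 j : 'rV[L]_n) x = x 0 j.
Proof.
rewrite row_formE (bigD1 j) //= mxE !eqxx mul1r big1 ?addr0 // => i ij.
by rewrite mxE (negPf ij) andbF mul0r.
Qed.

Lemma row_dual_linear s r (f : {linear 'rV[L^c]_s -> 'rV[L^c]_r}) :
  linear (fun y : 'rV[L]_r => \row_i row_form y (f (delta_mx 0 i)) : 'rV[L]_s).
Proof.
move=> a u v; apply/rowP => i; rewrite !mxE !row_formE mulr_sumr -big_split.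
by apply: eq_bigr => j _; rewrite !mxE mulrDl mulrA.
Qed.

Definition row_dual s r (f : {linear 'rV[L^c]_s -> 'rV[L^c]_r}) :
  {linear 'rV[L]_r -> 'rV[L]_s} := mklinear (row_dual_linear f).

Lemma row_dualE s r (f : {linear 'rV[L^c]_s -> 'rV[L^c]_r}) y i :
  row_dual f y 0 i = row_form y (f (delta_mx 0 i)).
Proof. by rewrite mxE. Qed.

Lemma row_form_dual s r (f : {linear 'rV[L^c]_s -> 'rV[L^c]_r}) y x :
  row_form (row_dual f y) x = row_form y (f x).
Proof.
apply: (@eq_linear_row _ _ _ (row_form (row_dual f y)) (row_form y \o f)) => i.
by rewrite row_form_delta row_dualE.
Qed.

(* A left inverse of the dual of f dualizes to a right inverse of f.          *)
Lemma row_dual_split s r (f : {linear 'rV[L^c]_s -> 'rV[L^c]_r})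
    (t : {linear 'rV[L]_s -> 'rV[L]_r}) :
  cancel (row_dual f) t -> surjective f.
Proof.
move=> tK y; exists (\sum_l y 0 l *: (\row_k (t (delta_mx 0 k) 0 l : L^c))).
rewrite linear_sum [y in RHS]row_sum_delta; apply: eq_bigr => l _.
rewrite linearZ; congr (_ *: _); apply/rowP => j.
have := congr1 (fun z : 'rV_r => z 0 l) (tK (delta_mx 0 j)).
rewrite linear_rowE summxE !mxE eq_sym => E; rewrite row_map_coord -[RHS]E.
by apply: eq_bigr => k _; rewrite [in RHS]mxE row_dualE row_form_coord mxE.
Qed.

Variables (n : nat -> nat)
  (d : forall i, {linear 'rV[L^c]_(n i.+1) -> 'rV[L^c]_(n i)})
  (S : lmodType L^c) (e : {linear 'rV[L^c]_(n 0) -> S}).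
Hypotheses (es : surjective e) (d0e : exact_at (d 0) e)
  (dd : forall i, exact_at (d i.+1) (d i)).

Definition row_resolution : resolution S :=
  @Resolution _ S (fun i => 'rV[L^c]_(n i)) d e
    (fun i => @row_projective _ (n i)) es d0e dd.


Lemma row_dual_inj : ~ Ext_neq0 0 S (L^c)^o -> injective (row_dual (d 0)).
Proof.
move=> nE; suff inj0 y : row_dual (d 0) y = 0 -> y = 0.
  move=> y z yz; apply/eqP; rewrite -subr_eq0; apply/eqP/inj0.
  by rewrite linearB yz subrr.
move=> dy; apply/rowP => i; rewrite -row_form_delta mxE.
apply: contrapT => y0; apply: nE; exists row_resolution, (row_form y).
split=> [x|/(_ (delta_mx 0 i))//].
by rewrite -[LHS]row_form_dual dy row_formE big1 // => j _; rewrite mxE mul0r.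
Qed.

Lemma row_dual_exact i : ~ Ext_neq0 i.+1 S (L^c)^o ->
  exact_at (row_dual (d i)) (row_dual (d i.+1)).
Proof.
move=> nE z; split=> [dz|[y <-]]; last first.
  apply/rowP => k; rewrite row_dualE row_form_dual mxE.
  by rewrite (exact_comp0 _ (@dd i)) linear0.
apply: contrapT => nz; apply: nE; exists row_resolution, (row_form z); split.
  by move=> x; rewrite -[LHS]row_form_dual dz row_formE big1 // => j _;
    rewrite mxE mul0r.
move=> [psi psiP]; apply: nz; exists (\row_j (psi (delta_mx 0 j) : L)).
apply/rowP => k; rewrite row_dualE -[RHS]row_form_delta psiP.
apply: (@eq_linear_row _ _ _ (row_form _) psi) => j.
by rewrite row_form_delta mxE.
Qed.

(** The cokernel at stage i is a syzygy of the cokernel at stage i + 1, so both bounds rise by one.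
    At stage 0, a projective cokernel would split the dual of d_0, making d_0 onto and S zero. *)
Lemma dual_cokernel_pd g (C : lmodType L) i (p : {linear 'rV[L]_(n i.+1) -> C}) :
  (exists x : S, x != 0) ->
  (forall j, (j < g)%N -> ~ Ext_neq0 j S (L^c)^o) -> (i < g)%N ->
  surjective p -> exact_at (row_dual (d i)) p -> pd_le i.+1 C /\ ~ pd_le i C.
Proof.
move=> [x x0] nE; elim: i C p => [|i IH] C p ig ps dp.
  have inj := row_dual_inj (nE _ ig).
  split=> [|Cp].
    exists 'rV_(n 1), 'rV_(n 0), (row_dual (d 0)), p.
    by split=> //; apply: row_projective.
  have [s sP] := Cp _ _ p idfun ps.
  have [t tP] : exists t : {linear 'rV[L]_(n 1) -> 'rV[L]_(n 0)},
      forall y, row_dual (d 0) (t y) = (idfun \- (s \o p)) y.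
    apply: factor_injective => // y; apply/dp.
    by rewrite /= linearB /= sP subrr.
  have ds : surjective (d 0).
    apply: (@row_dual_split _ _ _ t) => y; apply: inj.
    by rewrite tP /= (exact_comp0 _ dp) linear0 subr0.
  have [y yx] := es x; have [z zy] := ds y.
  by move: x0; rewrite -yx -zy (exact_comp0 _ d0e) eqxx.
have [D [q [qs dq]]] := cokernel_exists (row_dual (d i)).
have ex := row_dual_exact (nE _ ig).
have [Dpd nDpd] := IH D q (ltnW ig) qs dq.
have [|j jP] := factor_surjective (h := row_dual (d i.+1)) qs.
  by move=> y /dq/ex.
have jp : ses j p.
  split=> // [u v uv|y].
    apply/eqP; rewrite -subr_eq0; apply/eqP.
    have [w wuv] := qs (u - v); rewrite -wuv; apply/dq/ex.
    by rewrite -jP wuv linearB uv subrr.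
  rewrite dp; split=> [[w <-]|[w <-]]; first by exists (q w).
  by have [w' <-] := qs w; exists w'.
split.
  by exists 'rV_(n i.+2), D, j, p; split=> //; apply: row_projective.
by move=> Cpd; apply: nDpd; apply: pd_le_syzygy Cpd (@row_projective _ _) jp.
Qed.

End Dual.

Lemma enat_sup_le (X : enat -> Prop) z :
  (forall x, X x -> x <=oo z) -> enat_sup X <=oo z.
Proof.
case: z => [n Xn|_]; last by case: (enat_sup X).
exact: enat_inf_le.
Qed.

Lemma enat_le_sup (X : enat -> Prop) x : X x -> x <=oo enat_sup X.
Proof.
rewrite /enat_sup => Xx; case E: (enat_inf _) => [n|]; last by case: x {Xx}.
by have [/(_ _ Xx)] := enat_infP E.
Qed.

Lemma depth_le_findim (L : pzRingType) :
  left_noetherian L^c -> depth L <=oo findim_op L.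
Proof.
move=> noethL; apply: enat_sup_le => _ [S [fpS simS ->]].
case E: (findim_op L) => [m|]; last by case: (grade S).
apply: contrapT => nle.
(* With findim equal to m and grade S > m, Ext vanishes in degrees 0 to m, so the cokernel of the
   dual of d_m has projective dimension m + 1. *)
have nE j : (j < m.+1)%N -> ~ Ext_neq0 j S (L^c)^o.
  move=> jm Ej; apply: nle; have : grade S <=oo Some j by apply: enat_inf_le.
  by case: (grade S) => //= k /leq_trans; apply.
have [n [d [e [es d0e dd]]]] := free_resolution noethL (fp_fg fpS).
have [C [p [ps dp]]] := cokernel_exists (row_dual (d m)).
have [|Cle nC] := dual_cokernel_pd es d0e dd _ nE (ltnSn m) ps dp.
  by case: simS.
apply: nC; apply/projdim_le; rewrite -E; apply: enat_le_sup; exists C.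
split=> //; last by move/projdim_le: Cle; case: (projdim C).
by exists (n m), (n m.+1), (row_dual (d m)), p.
Qed.

(** * Purity and the delooping level *)

Lemma split_projective (A : pzRingType) (P Q M : lmodType A)
    (i : {linear P -> Q}) (p : {linear Q -> M}) (r : {linear Q -> P}) :
  projective Q -> ses i p -> cancel i r -> projective M.
Proof.
move=> Qp [ii ps ip] rK.
have [|s sP] := factor_surjective (h := idfun \- (i \o r)) ps.
  by move=> _ /ip[x <-]; rewrite /= rK subrr.
apply: (@projective_retract _ _ _ s p) => // y.
by have [x <-] := ps y; rewrite sP /= linearB /= (exact_comp0 _ ip) subr0.
Qed.

Section Purity.
Variables (L : pzRingType) (noethR : left_noetherian L^c).
Implicit Types (K M N P Q : lmodType L).

(* The family u lies in the image of [U (x) M -> L^k (x) M = M^k].            *)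
Definition in_scaled k (U : 'rV[L^c]_k -> Prop) M (u : 'I_k -> M) : Prop :=
  exists s (b : 'I_s -> 'rV[L^c]_k) (q : 'I_s -> M), (forall l, U (b l)) /\
    forall j, u j = \sum_l (b l 0 j : L) *: q l.

Lemma in_scaled_act k s (U : 'rV[L^c]_k -> Prop) M (u : 'I_k -> M)
    (b : {linear 'rV[L^c]_s -> 'rV[L^c]_k}) :
  (forall x, U x <-> exists c, b c = x) ->
  in_scaled U u <-> exists v, act b v = u.
Proof.
move=> Ub; split=> [[t [w [q [Uw uE]]]]|[v <-]]; last first.
  exists s, (fun i => b (delta_mx 0 i)), v; split=> // l.
  by apply/Ub; eexists.
have /choice[x xP] l : exists c, b c = w l by apply/Ub.
exists (fun i => \sum_l (x l 0 i : L) *: q l); apply: funext => j.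
rewrite uE /act; under eq_bigr => i _ do rewrite scaler_sumr.
rewrite exchange_big; apply: eq_bigr => l _ /=.
rewrite -xP row_map_coord scaler_suml; apply: eq_bigr => i _.
by rewrite scalerA.
Qed.

Definition simple_tor1_zero M : Prop :=
  forall S : lmodType L^c, finitely_presented S -> simple_module S -> tor1_zero S M.

(** Here S = L^k / U is simple and S (x) P = P^k / U P, so the claim is that S (x) P -> S (x) Q is
    injective, which Tor_1(S, M) = 0 provides. *)
Lemma simple_tor1_pure P Q M (i : {linear P -> Q}) (p : {linear Q -> M})
    k (U : 'rV[L^c]_k -> Prop) (u : 'I_k -> P) :
  ses i p -> simple_tor1_zero M -> submodule U -> (exists c, ~ U c) ->
  (forall Z', submodule Z' -> (forall x, U x -> Z' x) -> (exists c, ~ Z' c) ->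
    forall x, Z' x -> U x) ->
  in_scaled U (i \o u) -> in_scaled U u.
Proof.
move=> [ii ps ip] tM sU Up Umax.
have [S [f [fs fU]]] := quotient_exists sU.
have simS := simple_quotient fs fU Up Umax.
have fpS : finitely_presented S by apply: noetherian_fp => //; exists k, f.
have [s [b bf]] := noetherian_kernel noethR f.
have [t [c cb]] := noetherian_kernel noethR b.
have Ub x : U x <-> exists y, b y = x by rewrite -bf fU.
rewrite !(in_scaled_act _ Ub) => -[q bq].
have [|m mP] := tM S fpS simS _ _ _ _ _ _ fs bf cb (p \o q).
  by rewrite act_linear bq comp_exact0.
have [m' m'P] := comp_surjective_lift m ps.
have [|w wP] := comp_exact_lift (w := q - act c m') ip.
  by rewrite comp_linearB -act_linear m'P mP subrr.
exists w; apply: (comp_injective ii).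
by rewrite -act_linear wP actB (act_exact0 _ cb) subr0.
Qed.

Lemma fg_dual_basis P : finitely_generated P -> projective P ->
  exists k (q : 'I_k -> P) (phi : 'I_k -> {linear P -> L^o}),
    forall x, x = \sum_j (phi j x : L) *: q j.
Proof.
move=> [n [f fs]] Pp.
have [k [q [phi qP]]] := dual_basis (fun l => f (delta_mx 0 l)) Pp.
exists k, q, phi => x; have [c <-] := fs x.
rewrite linear_rowE; under [RHS]eq_bigr => j _ do rewrite linear_sum scaler_suml.
rewrite exchange_big; apply: eq_bigr => l _ /=.
rewrite [in LHS]qP scaler_sumr; apply: eq_bigr => j _.
by rewrite linearZ scalerA.
Qed.

(* If not every functional on P extended to Q, a maximal proper right         *)
(* submodule containing the extendable ones (in the coordinates of a dual     *)
(* basis) would give a simple S with [S (x) P -> S (x) Q] not injective.      *)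
Lemma simple_tor1_fg_projective P Q M (i : {linear P -> Q}) (p : {linear Q -> M}) :
  finitely_generated P -> projective P -> projective Q -> ses i p ->
  simple_tor1_zero M -> projective M.
Proof.
move=> fgP Pp Qp ip tM; have [k [x [phi xP]]] := fg_dual_basis fgP Pp.
(* Coordinate vectors of the functionals on P that extend to Q along i. *)
pose U (a : 'rV[L^c]_k) := exists psi : {linear Q -> L^o},
  forall y, \sum_j (phi j y : L) * (a 0 j : L) = psi (i y).
have sU : submodule U.
  split=> [|c a a' [psi psiP] [psi' psiP']].
    by exists \0 => y; rewrite big1 // => j _; rewrite mxE mulr0.
  have fL : linear (fun z => (psi z : L) * c + psi' z : L^o).
    move=> e u v; rewrite !linearP /= mulrDl addrACA scalerDr; congr (_ + _).
    by congr (_ + _); exact: (esym (mulrA _ _ _)).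
  exists (mklinear fL) => y /=; rewrite -psiP -psiP' mulr_suml -big_split.
  by apply: eq_bigr => j _; rewrite !mxE mulrDr mulrA.
have [/choice[psi psiP]|nU] := pselect (forall j, U (delta_mx 0 j)).
  have rL : linear (fun z => \sum_j (psi j z : L) *: x j).
    move=> e u v; rewrite scaler_sumr -big_split; apply: eq_bigr => j _.
    by rewrite linearP scalerDl scalerA.
  apply: (split_projective (r := mklinear rL) Qp ip) => y /=.
  rewrite [RHS]xP; apply: eq_bigr => j _; congr (_ *: _); rewrite -psiP.
  rewrite (bigD1 j) //= mxE !eqxx mulr1 big1 ?addr0 // => l lj.
  by rewrite mxE (negPf lj) andbF mulr0.
have [|Z [sZ UZ Zp Zmax]] := maximal_proper_row sU.
  apply: contrapT => nex; apply: nU => j; apply: contrapT => ?; apply: nex.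
  by eexists; eassumption.
have [|s [b [q [Zb bq]]]] := simple_tor1_pure (u := x) ip tM sZ Zp Zmax.
  (* The coefficients of i(x_j) in a dual basis of Q come from functionals on Q, so their rows lie
     in U. *)
  have [s [q [psi qP]]] := dual_basis (i \o x) Qp.
  exists s, (fun l => \row_j (psi l (i (x j)) : L^c)), q; split=> [l|j]; last first.
    by rewrite qP; apply: eq_bigr => l _; rewrite mxE.
  apply: UZ; exists (psi l) => y; rewrite {2}[y]xP !linear_sum.
  by apply: eq_bigr => j _; rewrite mxE !linearZ.
case: Zp => c []; rewrite [c]row_sum_delta; apply: submodule_sum => // l.
apply: submoduleZ => //.
(* The l-th unit vector and the row of all phi_l(x_j) define the same functional, so their
   difference lies in U; the row lies in Z by purity. Thus Z contains every unit vector. *)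
rewrite -[delta_mx 0 l](subrK (\row_j (phi l (x j) : L^c))).
apply: submoduleD => //.
  apply: UZ; exists \0 => y /=.
  under eq_bigr => j _ do rewrite !mxE mulrBr.
  rewrite sumrB (bigD1 l) //= eqxx mulr1 big1 ?addr0 => [|j jl]; last first.
    by rewrite (negPf jl) mulr0.
  rewrite {1}[y]xP linear_sum; apply/eqP; rewrite subr_eq0; apply/eqP.
  by apply: eq_bigr => j _; rewrite linearZ.
have -> : \row_j (phi l (x j) : L^c) = \sum_m (phi l (q m) : L^c) *: b m.
  apply/rowP => j; rewrite mxE summxE bq linear_sum.
  by apply: eq_bigr => m _; rewrite linearZ mxE.
by apply: submodule_sum => // m; apply: submoduleZ.
Qed.

End Purity.

(** * Dimension shifting along the delooping level *)

Section Delooping.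
Variables (L : pzRingType) (noethR : left_noetherian L^c).
Implicit Types (K M N P Q : lmodType L).

(** Arbitrary projectives are allowed, and the recursion removes the first syzygy, whereas
    [is_nth_syzygy] removes the last. A shift of Tor_1 takes the last syzygy off the right module
    and adds a first one to the left module. *)
Fixpoint nth_big_syzygy n M X : Prop :=
  match n with
  | 0%N => X = M
  | k.+1 => exists P K (i : {linear K -> P}) (p : {linear P -> M}),
      [/\ projective P, ses i p & nth_big_syzygy k K X]
  end.

Lemma nth_big_syzygy_add m n M N : nth_big_syzygy (m + n) M N ->
  exists K, nth_big_syzygy m M K /\ nth_big_syzygy n K N.
Proof.
elim: m M => [|m IH] M /=; first by exists M.
move=> [P [K [i [p [Pp ip /IH[X [KX XN]]]]]]].
by exists X; split=> //; exists P, K, i, p.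
Qed.

Lemma nth_big_syzygyS n M N P K (i : {linear K -> P}) (p : {linear P -> N}) :
  nth_big_syzygy n M N -> projective P -> ses i p -> nth_big_syzygy n.+1 M K.
Proof.
move=> MN Pp ip; elim: n M MN => [|n IH] M /=; last first.
  by move=> [P' [K' [i' [p' [Pp' ip' /IH K'K]]]]]; exists P', K', i', p'.
by move=> NM; case: _ / NM; exists P, K, i, p.
Qed.

Lemma pd_le_nth_syzygy n M N :
  nth_big_syzygy n M N -> projective N -> pd_le n M.
Proof.
move=> MN Np; elim: n M MN => [|n IH] M /=; first by move=> <-.
by move=> [P [K [i [p [Pp ip /IH Kn]]]]]; exists P, K, i, p.
Qed.

Lemma syzygy_fg (X Y : lmodType L^c) : is_syzygy X Y -> finitely_generated Y.
Proof.
move=> [P [i [p [fpP _ ii _ _]]]].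
exact: (noetherian_sub_fg noethR ii (fp_fg fpP)).
Qed.

Lemma tor1_zero_nth_shift k (X Y : lmodType L^c) M N :
  finitely_generated X -> is_nth_syzygy k X Y -> nth_big_syzygy k M N ->
  finitely_generated Y /\ (tor1_zero Y M <-> tor1_zero X N).
Proof.
move=> fgX; elim: k Y M => [|k IH] Y M /=; first by move=> -> ->.
move=> [Z [XZ ZY]] [Q [K [i' [p' [Qp ip' KN]]]]].
have [fgZ <-] := IH _ _ XZ KN; have fgY := syzygy_fg ZY.
case: ZY => P [i [p [fpP Pp ii ps ip]]]; split=> //.
exact: (tor1_zero_shift noethR fgZ fgY Pp (And3 ii ps ip) Qp ip').
Qed.

(** Write N = Omega^m M' with m = dell S. Then Tor_1(S, N) is Tor_1(Omega^m S, M'), controlled by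
    Tor_1(Omega^(m+1) D, M'), which vanishes along with Tor_1(D, K) since K is projective. *)
Lemma dell_tor1_zero (S : lmodType L^c) e M N P K (i : {linear K -> P})
    (p : {linear P -> N}) :
  finitely_presented S -> dell_module S <=oo Some e -> nth_big_syzygy e M N ->
  projective P -> projective K -> ses i p -> tor1_zero S N.
Proof.
rewrite /dell_module; case E: (enat_inf _) => [m|//] /= fpS me MN Pp Kp ip.
have [[D [X [Y [fpD SX DY XY]]]] _] := enat_infP E.
move: MN; rewrite -(subnK me) => /nth_big_syzygy_add[M' [_ M'N]].
have [_ <-] := tor1_zero_nth_shift (fp_fg fpS) SX M'N.
have [fgY YM'] := tor1_zero_nth_shift (fp_fg fpD) DY (nth_big_syzygyS M'N Pp ip).
have tY : tor1_zero Y M' by apply/YM'/tor1_zero_projective.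
have [n [f fs]] := fgY; have [n1 [f1 f1f]] := noetherian_kernel noethR f.
have [n2 [f2 f2f1]] := noetherian_kernel noethR f1.
apply: (tor1_zero_stable fs f1f f2f1 (tY _ _ _ _ _ _ fs f1f f2f1)).
exact: stable_retract_big.
Qed.

(** [good] is a class of modules closed under suitable syzygies. If projdim M = e + 1 exceeded dell
    L, then N = Omega^e M, whose syzygy K is projective, would itself be projective by [spl], giving
    projdim M at most e. *)
Lemma projdim_le_dell (good : lmodType L -> Prop) M :
  (forall M, good M -> exists P K (i : {linear K -> P}) (p : {linear P -> M}),
     [/\ projective P, ses i p & good K]) ->
  (forall P Q N (i : {linear P -> Q}) (p : {linear Q -> N}), good P ->
     projective P -> projective Q -> ses i p -> simple_tor1_zero N ->
     projective N) ->
  good M -> projdim M <> None -> projdim M <=oo dell L.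
Proof.
move=> cov spl gM; case Ed: (projdim M) => [d|//] _.
case En: (dell L) => [n|//] /=; rewrite leqNgt; apply/negP => nd.
case: d => [//|e] in Ed nd *.
have Me : pd_le e.+1 M by apply/projdim_le; rewrite Ed /=.
have [N [P [K [i [p [MN [Pp Kp gK ip]]]]]]] : exists N P K (i : {linear K -> P})
    (p : {linear P -> N}), nth_big_syzygy e M N /\
    [/\ projective P, projective K, good K & ses i p].
  elim: e M gM Me {Ed nd} => [|e IH] M gM Me.
    have [P [K [i [p [Pp ip gK]]]]] := cov _ gM.
    by exists M, P, K, i, p; split=> //; split=> //; apply: pd_le_syzygy Me Pp ip.
  have [P [K [i [p [Pp ip gK]]]]] := cov _ gM.
  have [N [Q [K' [i' [p' [KN H]]]]]] := IH _ gK (pd_le_syzygy Me Pp ip).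
  by exists N, Q, K', i', p'; split=> //; exists P, K, i, p.
have Np : projective N.
  apply: (spl _ _ _ _ _ gK Kp Pp ip) => S fpS simS.
  apply: (dell_tor1_zero fpS _ MN Pp Kp ip).
  have : dell_module S <=oo dell L by apply: enat_le_sup; exists S.
  by rewrite En; case: (dell_module S) => //= m /leq_trans; apply.
have /projdim_le := pd_le_nth_syzygy MN Np.
by rewrite Ed /= ltnn.
Qed.

End Delooping.

Lemma findim_le_dell (L : pzRingType) :
  noetherian L -> findim_op L <=oo dell L.
Proof.
move=> [noethL noethR]; apply: enat_sup_le => _ [M [fpM Mfin ->]].
apply: (projdim_le_dell noethR (good := @finitely_generated L)) Mfin.
- move=> N [n [p ps]]; have [K [i ip]] := kernel_ses ps.
  exists 'rV_n, K, i, p; split=> //; first exact: row_projective.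
  case: ip => ii _ _; apply: noetherian_sub_fg ii _ => //.
  by exists n, idfun => y; exists y.
- by move=> P Q N i p; apply: simple_tor1_fg_projective.
- exact: fp_fg.
Qed.

(** * The radical of an Artinian ring *)

Section Radical.
Variable L : pzRingType.
Implicit Types (a b c x y : L).

Definition two_sided_unit x : Prop := exists y, y * x = 1 /\ x * y = 1.

Lemma two_sided_unitM x y :
  two_sided_unit x -> two_sided_unit y -> two_sided_unit (x * y).
Proof.
move=> [x' [x'x xx']] [y' [y'y yy']]; exists (y' * x'); split.
  by rewrite mulrA -(mulrA y') x'x mulr1.
by rewrite mulrA -(mulrA x) yy' mulr1.
Qed.

(** If y is the inverse of 1 - ab, then 1 + b y a is the inverse of 1 - ba. *)
Lemma two_sided_unit_swap a b :
  two_sided_unit (1 - a * b) -> two_sided_unit (1 - b * a).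
Proof.
move=> [y [y1 y2]]; exists (1 + b * y * a).
have E1 : y * a * b = y - 1 by rewrite -[in RHS]y1 mulrBr mulr1 mulrA subKr.
have E2 : a * b * y = y - 1 by rewrite -[in RHS]y2 mulrBl mul1r subKr.
split.
  rewrite mulrBr mulr1 mulrDl mul1r.
  have -> : b * y * a * (b * a) = b * (y * a * b) * a by rewrite !mulrA.
  by rewrite E1 mulrBr mulr1 mulrBl addrCA subrr addr0 addrK.
rewrite mulrBl mul1r mulrDr mulr1.
have -> : b * a * (b * y * a) = b * (a * b * y) * a by rewrite !mulrA.
by rewrite E2 mulrBr mulr1 mulrBl addrCA subrr addr0 addrK.
Qed.

(* The Jacobson radical, in a left-right symmetric form.                      *)
Definition radical x : Prop := forall a b, two_sided_unit (1 - a * x * b).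

Lemma radicalMl c x : radical x -> radical (c * x).
Proof. by move=> rx a b; rewrite mulrA. Qed.

Lemma radicalMr c x : radical x -> radical (x * c).
Proof. by move=> rx a b; rewrite mulrA -mulrA. Qed.

Lemma radical0 : radical 0.
Proof. by move=> a b; rewrite mulr0 mul0r subr0; exists 1; rewrite mulr1. Qed.

Lemma radicalD x y : radical x -> radical y -> radical (x + y).
Proof.
move=> rx ry a b; have [z [z1 z2]] := rx a b.
have -> : 1 - a * (x + y) * b = (1 - a * x * b) * (1 - (z * a) * y * b).
  by rewrite mulrBr mulr1 !mulrA z2 mul1r mulrDr mulrDl opprD addrA.
by apply: two_sided_unitM; [exact: rx|exact: ry].
Qed.

Lemma radical_submodule : submodule (radical : L^o -> Prop).
Proof.
split=> [|a u v ru rv]; first exact: radical0.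
exact: radicalD (radicalMl a ru) rv.
Qed.


(** A left inverse y of 1 - ax equals 1 + y a x, so it has a left inverse too; hence y is a unit
    with inverse 1 - ax. *)
Lemma radical_left x : (forall a, exists y, y * (1 - a * x) = 1) -> radical x.
Proof.
move=> lx a b; apply: two_sided_unit_swap; rewrite mulrA; move: (b * a) => {a b} a.
have [y yP] := lx a; have [z zP] := lx (- (y * a)).
have yE : 1 - - (y * a) * x = y.
  by rewrite mulNr opprK -mulrA -yP mulrBr mulr1 subrK.
rewrite yE in zP; have zE : z = 1 - a * x.
  by rewrite -[LHS]mulr1 -[X in z * X]yP mulrA zP mul1r.
by exists y; split; rewrite // -zE.
Qed.

Lemma radical_right x : (forall a, exists y, (1 - x * a) * y = 1) -> radical x.
Proof.
move=> rx a b; rewrite -mulrA; apply: two_sided_unit_swap; rewrite -mulrA.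
move: (b * a) => {a b} a.
have [y yP] := rx a; have [z zP] := rx (- (a * y)).
have yE : 1 - x * - (a * y) = y.
  by rewrite mulrN opprK mulrA -yP mulrBl mul1r subrK.
rewrite yE in zP; have zE : z = 1 - x * a.
  by rewrite -[LHS]mul1r -[X in X * z]yP -mulrA zP mulr1.
by exists y; split; rewrite // -zE.
Qed.

Lemma artinian_minimal (G : (L^o -> Prop) -> Prop) : left_artinian L ->
  (exists W, submodule W /\ G W) ->
  exists W, [/\ submodule W, G W & forall V, submodule V -> G V ->
    (forall x, V x -> W x) -> forall x, W x -> V x].
Proof.
move=> artL [W0 W0P]; apply: contrapT => nmin.
pose T := {W : L^o -> Prop | submodule W /\ G W}.
have /choice[nxt nxtP] (W : T) : exists V : T,
    (forall x, sval V x -> sval W x) /\ exists x, sval W x /\ ~ sval V x.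
  case: W => W [sW GW] /=; apply: contrapT => nV; apply: nmin.
  exists W; split=> // V sV GV VW x Wx; apply: contrapT => Vx.
  by apply: nV; exists (exist _ V (conj sV GV)); split=> //; exists x.
pose st n := iter n nxt (exist _ W0 W0P : T).
have [n|n x /submodule_predE|n nP] :=
    artL (fun n => submodule_pred (sval (st n))).
- by apply: submodule_closed; case: (svalP (st n)).
- by move=> h; apply/submodule_predE; case: (nxtP (st n)) => + _; apply.
have [_ [x [Wx Vx]]] := nxtP (st n); apply: Vx.
apply: (iffLR (@submodule_predE _ _ (sval (st n.+1)) x)).
by rewrite (nP n.+1 (leqnSn n)); apply/submodule_predE.
Qed.

(** W' is minimal among the left ideals that contain J and satisfy W + W' = L. For y = ax in the
    intersection, W'(1 - y) + J is another such ideal inside W', so it equals W' and contains y. *)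
Lemma complement_mod_radical (W : L^o -> Prop) : left_artinian L ->
  submodule W -> exists W' : L^o -> Prop, [/\ submodule W',
    forall a, exists w w', [/\ W w, W' w' & a = w + w']
    & forall x, W x -> W' x -> radical x].
Proof.
move=> artL sW; have sr := radical_submodule.
pose G (V : L^o -> Prop) := (forall x, radical x -> V x) /\
  forall a, exists w v, [/\ W w, V v & a = w + v].
have [|W' [sW' [rW' sumW'] min]] := @artinian_minimal G artL.
  exists (fun=> True); do ![split=> //] => a; exists 0, a.
  by rewrite add0r; case: sW.
exists W'; split=> // x Wx W'x; apply: radical_left => a.
pose y : L^o := a * x.
have Wy : W y by exact: submoduleZ.
have W'y : W' y by exact: submoduleZ.
pose V (v : L^o) := exists w' j, [/\ W' w', radical j & v = w' * (1 - y) + j].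
have [||||w' [j [W'w' rj yE]]] := min V _ _ _ y.
- split=> [|c u v [w [j [W'w rj ->]]] [w' [j' [W'w' rj' ->]]]].
    by exists 0, 0; rewrite mul0r addr0; case: sW' => ? _; split=> //;
      exact: radical0.
  exists (c * w + w'), (c * j + j'); split.
  + by case: sW' => _; apply.
  + by case: sr => _; apply.
  + by rewrite mulrDl addrACA -mulrA -mulrDr.
- split=> [j rj|c].
    by exists 0, j; rewrite mul0r add0r; case: sW'.
  have [w [w' [Ww W'w' ->]]] := sumW' c.
  exists (w + w' * y), (w' * (1 - y)); split.
  + by apply: submoduleD => //; exact: submoduleZ.
  + by exists w', 0; rewrite addr0; split=> //; exact: radical0.
  + by rewrite -addrA -mulrDr [y + _]addrC subrK mulr1.
- move=> _ [w' [j [W'w' rj ->]]]; apply: submoduleD; rewrite // ?mulrBr ?mulr1.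
    by apply: submoduleB => //; exact: submoduleZ.
  exact: rW'.
- by [].
(* From y = w'(1 - y) + j follows (1 + w')(1 - y) = 1 - j, a unit. *)
have [z [z1 _]] := rj 1 1; rewrite mul1r mulr1 in z1.
exists (z * (1 + w')); rewrite -mulrA -[RHS]z1; congr (_ * _).
by rewrite mulrDl mul1r -/y {1}yE opprD addrA addrAC subrK.
Qed.

Fixpoint radical_power k : L^o -> Prop :=
  match k with
  | 0%N => fun=> True
  | n.+1 => fun x => forall V : L^o -> Prop, submodule V ->
      (forall j y, radical j -> radical_power n y -> V (j * y)) -> V x
  end.

Lemma radical_power_submodule k : submodule (radical_power k).
Proof.
case: k => [//|k]; split=> [V [] //|a u v hu hv V sV hV].
by case: (sV) => _; apply; [exact: hu|exact: hv].
Qed.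

Lemma radical_powerM k j y :
  radical j -> radical_power k y -> radical_power k.+1 (j * y).
Proof. by move=> rj ky V sV; apply. Qed.

(** The powers of J stabilize at some J^n = J J^n, and J^n is finitely generated, so Nakayama's
    argument applies. *)
Lemma radical_nilpotent : left_noetherian L -> left_artinian L ->
  exists k, forall x, radical_power k x -> x = 0.
Proof.
move=> noethL artL.
have dec n x : radical_power n.+1 x -> radical_power n x.
  move=> h; apply: (h); first exact: radical_power_submodule.
  by move=> j y _ ny; apply: submoduleZ => //; exact: radical_power_submodule.
have [n|n x /submodule_predE h|n nP] :=
    artL (fun n => submodule_pred (radical_power n)).
- exact/submodule_closed/radical_power_submodule.
- exact/submodule_predE/dec.
exists n; have stab x : radical_power n x -> radical_power n.+1 x.
  move=> h; apply: (iffLR (@submodule_predE _ _ (radical_power n.+1) x)).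
  by rewrite (nP n.+1 (leqnSn n)); apply/submodule_predE.
have [s [sn ns]] := noetherian_ideal_fg noethL (radical_power_submodule n).
(* Generators are discarded one at a time: x = jx + g with j in J makes x a multiple of g. *)
elim: s sn ns => [|x s IH] sn ns.
  move=> x /ns h; apply: (h (fun x => x = 0)) => //.
  by split=> // a u v -> ->; rewrite scaler0 addr0.
have sg := generated_submodule s.
suff gx : generated s x.
  apply: IH => [y ys|y /ns]; first by apply: sn; rewrite inE ys orbT.
  apply: generated_sub => z; rewrite inE => /orP[/eqP ->//|].
  exact: generated_mem.
have [||j [g [rj gg xE]]] := stab x (sn x (mem_head _ _))
    (fun v => exists j g, [/\ radical j, generated s g & v = j *: x + g]).
- split=> [|c u v [j [g [rj gg ->]]] [j' [g' [rj' gg' ->]]]].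
    exists 0, 0; rewrite scale0r addr0; split=> //; first exact: radical0.
    exact: (proj1 sg).
  exists (c * j + j'), (c *: g + g'); split.
  + exact: (proj2 radical_submodule).
  + exact: (proj2 sg).
  + by rewrite scalerDr scalerDl addrACA scalerA.
- move=> j y rj /ns/generated_cons[a [g [gg ->]]].
  exists (j * a), (j *: g); split; first exact: radicalMr.
    exact: (submoduleZ _ sg).
  by rewrite -[j * _]/(j *: _) scalerDr scalerA.
have [z [z1 _]] := rj 1 1; rewrite mul1r mulr1 in z1.
have gE : g = (1 - j) *: x by rewrite scalerBl scale1r {1}xE addrC addKr.
have -> : x = z *: g by rewrite gE scalerA z1 scale1r.
exact: (submoduleZ _ sg).
Qed.

End Radical.

(** * Artinian splitting *)

Section ArtinianSplitting.
Variables (L : pzRingType) (noethR : left_noetherian L^c).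
Hypotheses (noethL : left_noetherian L) (artL : left_artinian L).
Implicit Types (M N P Q : lmodType L).

Definition radical_submod M (x : M) : Prop :=
  exists r : seq (L * M), (forall t, t \in r -> radical t.1) /\
    x = \sum_(t <- r) t.1 *: t.2.

Lemma radical_submod_submodule M : submodule (@radical_submod M).
Proof.
split=> [|a _ _ [r [rr ->]] [r' [rr' ->]]]; first by exists [::]; rewrite big_nil.
exists ([seq (a * t.1, t.2) | t <- r] ++ r'); split=> [t|].
  rewrite mem_cat => /orP[/mapP[t' t'r ->]|/rr'//].
  exact/radicalMl/rr.
rewrite big_cat big_map scaler_sumr; congr (_ + _); apply: eq_bigr => t _ /=.
by rewrite scalerA.
Qed.

Lemma radical_submodZ M a (x : M) : radical a -> radical_submod (a *: x).
Proof.
by move=> ra; exists [:: (a, x)]; rewrite big_seq1; split=> // t;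
  rewrite inE => /eqP ->.
Qed.

(** Otherwise the maximal right ideal U and aL would span L, giving a unit 1 - ab in U. *)
Lemma radical_in_maximal (U : 'rV[L^c]_1 -> Prop) (a : L) :
  submodule U -> (exists c, ~ U c) ->
  (forall Z', submodule Z' -> (forall x, U x -> Z' x) -> (exists c, ~ Z' c) ->
    forall x, Z' x -> U x) ->
  radical a -> U (const_mx (a : L^c)).
Proof.
move=> sU [c Uc] Umax ra.
pose Z' (x : 'rV[L^c]_1) := exists m b, U m /\ x = m + const_mx (a * b : L^c).
apply: (Umax Z').
- split=> [|d u v [m [b [Um ->]]] [m' [b' [Um' ->]]]].
    exists 0, 0; split; first by case: sU.
    by rewrite mulr0 add0r; apply/rowP => j; rewrite !mxE.
  exists (d *: m + m'), ((b : L) * (d : L) + b'); split.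
    by case: sU => _; apply.
  apply/rowP => j; rewrite !mxE [d * (m 0 j + _)]mulrDr addrACA; congr (_ + _).
  by rewrite mulrDr; congr (_ + _); exact: mulrA.
- move=> x Ux; exists x, 0; split=> //.
  by apply/rowP => j; rewrite !mxE mulr0 addr0.
- exists (const_mx 1) => -[m [b [Um mE]]]; apply: Uc.
  have {}mE : m = const_mx (1 - a * b : L^c).
    apply/rowP => j; have := congr1 (fun w : 'rV_1 => w 0 j) mE.
    by rewrite !mxE => E; rewrite -[LHS](addrK (a * b : L^c)) -E.
  have [y [_ yP]] := ra 1 b; rewrite mul1r in yP.
  have -> : c = (c 0 0 : L^c) *: ((y : L^c) *: m).
    apply/rowP => j; rewrite mE !mxE [j]ord1.
    have -> : (y : L^c) * (1 - a * b : L^c) = 1 by exact: yP.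
    by rewrite mulr1.
  by do 2!apply: submoduleZ => //.
- exists 0, 1; split; first by case: sU.
  by apply/rowP => j; rewrite !mxE mulr1 add0r.
Qed.

(** If a coordinate y = phi_j(x) were outside J, some 1 - yc would lie in a maximal right ideal Z.
    As J lies in Z, purity puts x in Z P, so y is in Z and then 1 is in Z. *)
Lemma radical_submod_pure P Q M (i : {linear P -> Q}) (p : {linear Q -> M}) x :
  projective P -> ses i p -> simple_tor1_zero M ->
  radical_submod (i x) -> radical_submod x.
Proof.
move=> Pp ip tM [r [rr ixE]].
have [k [q [phi xE]]] := dual_basis (fun _ : 'I_1 => x) Pp.
rewrite (xE ord0); apply: submodule_sum; first exact: radical_submod_submodule.
move=> j; apply: radical_submodZ; apply: radical_right => c.
apply: contrapT => ninv; set y : L := phi j x in ninv.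
pose U (a : 'rV[L^c]_1) := exists b : L, a = const_mx ((1 - y * c) * b : L^c).
have sU : submodule U.
  split=> [|d _ _ [b ->] [b' ->]].
    by exists 0; apply/rowP => l; rewrite !mxE mulr0.
  exists (b * (d : L) + b'); apply/rowP => l; rewrite !mxE mulrDr; congr (_ + _).
  exact: mulrA.
have [|Z [sZ UZ Zp Zmax]] := maximal_proper_row sU.
  exists (const_mx 1) => -[b bE]; apply: ninv; exists b.
  by have := congr1 (fun w : 'rV_1 => w 0 0) bE; rewrite !mxE.
have [|s [b [w [Zb bw]]]] := simple_tor1_pure noethR (u := fun=> x) ip tM sZ Zp Zmax.
  exists (size r), (fun l => const_mx ((nth (0, 0) r l).1 : L^c)),
    (fun l => (nth (0, 0) r l).2); split=> [l|l].
    by apply: radical_in_maximal => //; apply/rr/mem_nth.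
  rewrite /= ixE (big_nth (0, 0)) big_mkord; apply: eq_bigr => m _.
  by rewrite mxE.
have Zy : Z (const_mx (y : L^c)).
  have -> : const_mx (y : L^c) = \sum_m (phi j (w m) : L^c) *: b m.
    apply/rowP => l; rewrite mxE summxE /y (bw l) linear_sum.
    by apply: eq_bigr => m _; rewrite linearZ mxE.
  by apply: submodule_sum => // m; apply: submoduleZ.
case: Zp => d [].
have -> : d = (d 0 0 : L^c) *:
    (const_mx (1 - y * c : L^c) + (c : L^c) *: const_mx (y : L^c)).
  apply/rowP => l; rewrite !mxE [l]ord1.
  have -> : (1 - y * c : L^c) + (c : L^c) * (y : L^c) = 1 by exact: subrK.
  by rewrite mulr1.
apply: submoduleZ => //; apply: submoduleD => //; last exact: submoduleZ.
by apply: UZ; exists 1; rewrite mulr1.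
Qed.

(* A submodule of Q maximal among those meeting P in [J P] is a complement of *)
(* P modulo [J P], because left ideals have complements modulo J.             *)
Lemma split_mod_radical P Q M (i : {linear P -> Q}) (p : {linear Q -> M}) :
  projective P -> projective Q -> ses i p -> simple_tor1_zero M ->
  exists r : {linear Q -> P}, forall x, radical_submod (x - r (i x)).
Proof.
move=> Pp Qp ip tM; have sJP := @radical_submod_submodule P.
have sJQ := @radical_submod_submodule Q.
pose G (Z : Q -> Prop) := forall x, Z (i x) -> radical_submod x.
have [|F _ FG _ x [Z [FZ /FG]]|Z [sZ JZ GZ Zmax]] := @maximal_submodule _ _ _ G sJQ.
- by move=> x; exact: radical_submod_pure Pp ip tM.
- exact.
have ZP q : exists x, Z (q - i x).
  (* W consists of the a with aq in Z + P; the goal is 1 in W. For a complement W' modulo J, Z + W'q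
     still meets P in J P, so maximality of Z gives W'q in Z and W' inside W. *)
  pose W (a : L^o) := exists x, Z ((a : L) *: q - i x).
  have sW : submodule W.
    split=> [|a u v [x Zx] [y Zy]].
      by exists 0; rewrite scale0r linear0 subr0; case: sZ.
    exists (a *: x + y); rewrite linearP scalerDl opprD addrACA -scalerA -scalerBr.
    by case: sZ => _; apply.
  have [W' [sW' sumW WW']] := complement_mod_radical artL sW.
  pose Z' v := exists z (a : L), [/\ Z z, W' a & v = z + a *: q].
  have Z'Z : forall v, Z' v -> Z v.
    apply: Zmax.
    - split=> [|c _ _ [z [a [Zz Wa ->]]] [z' [a' [Zz' Wa' ->]]]].
        exists 0, 0; rewrite scale0r addr0.
        by split=> //; [case: sZ|case: sW'].
      exists (c *: z + z'), (c * a + a'); split.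
      + by case: sZ => _; apply.
      + by case: sW' => _; apply.
      + by rewrite scalerDr scalerDl addrACA scalerA.
    - move=> v Zv; exists v, 0; rewrite scale0r addr0; split=> //.
      by case: sW'.
    - move=> x [z [a [Zz W'a ixE]]]; apply: GZ; rewrite ixE; apply: submoduleD => //.
      apply/JZ/radical_submodZ/WW' => //; exists x.
      by rewrite ixE opprD addrCA subrr addr0 -sub0r;
        apply: submoduleB => //; case: sZ.
  suff [x] : W 1 by rewrite scale1r; exists x.
  have [w [w' [Ww W'w' ->]]] := sumW 1; apply: submoduleD => //.
  exists 0; rewrite linear0 subr0; apply: Z'Z; exists 0, w'; rewrite add0r.
  by split=> //; case: sZ.
(* The P-component of q is determined modulo J P, which gives a linear map Q -> P / J P; it lifts to
   P because Q is projective. *)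
have [B [b [bs bJ]]] := quotient_exists sJP.
have [t tP] := choice ZP.
have bE x y : Z (i x - i y) -> b x = b y.
  rewrite -linearB => /GZ/bJ/eqP; rewrite linearB subr_eq0 => /eqP //.
have tL : linear (fun q => b (t q)).
  move=> a u v; rewrite -linearP; apply: bE.
  rewrite -(subrKA (a *: u + v)); apply: submoduleD => //.
    by rewrite -opprB -sub0r; apply: submoduleB => //; case: sZ.
  rewrite linearP opprD addrACA -scalerBr.
  by case: sZ => _; apply.
have [r rP] := Qp _ _ b (mklinear tL) bs.
exists r => x; apply/bJ; rewrite linearB rP /=.
apply/eqP; rewrite subr_eq0; apply/eqP.
by apply: bE; apply: tP.
Qed.

(** The error u = 1 - r i maps P into J P, so it is nilpotent, and a geometric series in u corrects
    r to a true retraction. *)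
Lemma simple_tor1_artinian_projective P Q M (i : {linear P -> Q})
    (p : {linear Q -> M}) :
  projective P -> projective Q -> ses i p -> simple_tor1_zero M -> projective M.
Proof.
move=> Pp Qp ip tM; have [r rP] := split_mod_radical Pp Qp ip tM.
pose u : {linear P -> P} := idfun \- (r \o i).
have iterL k : exists g : {linear P -> P}, forall x, g x = iter k u x.
  elim: k => [|k [g gP]]; first by exists idfun.
  by exists (u \o g) => x; rewrite iterS -gP.
(* That u^k maps P into J^k P is tested on functionals, which suffices by the dual basis lemma. *)
have iterJ k : forall (phi : {linear P -> L^o}) x,
    radical_power k (phi (iter k u x)).
  elim: k => [//|k IH] phi x; rewrite iterSr; have [g gP] := iterL k.
  have [s [sr usE]] : radical_submod (u x) by exact: rP.
  rewrite usE -gP !linear_sum big_seq.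
  apply: (big_ind (radical_power k.+1)) => [|y z hy hz|t /sr rt].
  - exact: (proj1 (radical_power_submodule L k.+1)).
  - exact: (submoduleD (radical_power_submodule L k.+1)).
  - by rewrite !linearZ gP; apply: radical_powerM.
have [k kP] := radical_nilpotent noethL artL.
have u0 x : iter k u x = 0.
  have [n [q [phi xE]]] := dual_basis (fun _ : 'I_1 => iter k u x) Pp.
  rewrite (xE ord0) big1 // => j _.
  by rewrite (kP _ (iterJ _ _ _)) scale0r.
(* r' is the sum of u^l r over l < k, built by replacing r' with r + u r'. *)
have [r' r'P] : exists r' : {linear Q -> P}, forall x, r' (i x) = x - iter k u x.
  elim: (k) => [|l [r' r'P]]; first by exists \0 => x /=; rewrite subrr.
  exists (r \+ (u \o r')) => x.
  transitivity (r (i x) + (u x - u (iter l u x))).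
    by rewrite -linearB -r'P.
  by rewrite -iterS addrA [r (i x) + _]addrC /= subrK.
apply: (split_projective (r := r') Qp ip) => x.
by rewrite r'P u0 subr0.
Qed.

End ArtinianSplitting.

(** * The Artinian bound and the chain of inequalities *)

Lemma Findim_le_dell (L : pzRingType) :
  noetherian L -> artinian L -> Findim_op L <=oo dell L.
Proof.
move=> [noethL noethR] [artL _]; apply: enat_sup_le => _ [M [Mfin ->]].
apply: (projdim_le_dell noethR (good := fun=> True)) Mfin => //.
- move=> N _; have [P [p [Pp ps]]] := enough_projectives N.
  by have [K [i ip]] := kernel_ses ps; exists P, K, i, p.
- by move=> P Q N i p _; apply: simple_tor1_artinian_projective.
Qed.

Theorem proposition1p3 (Lambda : pzRingType)
    (noethL : noetherian Lambda) (semiperfL : semiperfect Lambda) :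
  (depth Lambda <=oo findim_op Lambda /\ findim_op Lambda <=oo dell Lambda) /\
  (artinian Lambda ->
    [/\ depth Lambda <=oo findim_op Lambda,
        findim_op Lambda <=oo Findim_op Lambda
      & Findim_op Lambda <=oo dell Lambda]).
Proof.
have depthL := depth_le_findim (proj2 noethL).
have findimL := findim_le_dell noethL.
split=> // artL; split=> //; last exact: Findim_le_dell.
apply: enat_sup_le => _ [M [fpM Mfin ->]].
by apply: enat_le_sup; exists M.
Qed.
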